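(* Let $T$ be a translation generalised quadrangle of order $(q^n,q^{2n})$ with base point $(\infty)$. Suppose that there are two distinct lines $\ell_1,\ell_2$ of $T$ through $(\infty)$ such that for every two distinct lines $m_1,m_2$ through $(\infty)$, with $m_1,m_2$ both different from $\ell_1$ and $\ell_2$, and for each $i\in\{1,2\}$, there is a subquadrangle of order $q^n$ of $T$ containing $m_1,m_2,\ell_i$. Then $T$ is isomorphic to $T_3(\mathcal{O})$, where $\mathcal{O}$ is an ovoid of $\mathrm{PG}(3,q^n)$.
   Context: $\mathrm{PG}(r,q)$ is the $r$-dimensional projective space over $\mathbb{F}_q$; dimensions are projective. A generalised quadrangle of order $(s,t)$, $s,t>1$, is a point-line incidence structure such that every line has exactly $s+1$ points, through every point there are exactly $t+1$ lines, and for every point $P$ not on a line $L$ there is exactly one line through $P$ meeting $L$. Order $s$ means order $(s,s)$. A subquadrangle is a substructure (subsets of points and lines with the induced incidence) which is itself a generalised quadrangle. An egg in $\mathrm{PG}(2n+m-1,q)$ is a set $\mathcal{E}$ of $q^m+1$ $(n-1)$-spaces, any three of which span a $(3n-1)$-space, such that each $E\in\mathcal{E}$ is contained in an $(n+m-1)$-space $T_E$ (the tangent space at $E$) which is skew from every element of $\mathcal{E}$ different from $E$. Given an egg $\mathcal{E}$ in $\Sigma_\infty=\mathrm{PG}(2n+m-1,q)$, embed $\Sigma_\infty$ as a hyperplane in $\mathrm{PG}(2n+m,q)$. The generalised quadrangle $T(\mathcal{E})$ has points: (i) the points of $\mathrm{PG}(2n+m,q)$ not in $\Sigma_\infty$;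 (ii) the $(n+m)$-spaces meeting $\Sigma_\infty$ exactly in $T_E$ for some $E\in\mathcal{E}$; (iii) a symbol $(\infty)$. Its lines are: (a) the $n$-spaces meeting $\Sigma_\infty$ exactly in an element of $\mathcal{E}$; (b) the elements of $\mathcal{E}$. A point of type (i) is incident with the lines of type (a) through it; a point of type (ii) is incident with the lines of type (a) it contains and the line of type (b) it contains; $(\infty)$ is incident with all lines of type (b). $T(\mathcal{E})$ has order $(q^n,q^m)$. A translation generalised quadrangle of order $(q^n,q^{2n})$ with base point $(\infty)$ is one (isomorphic to one) of the form $T(\mathcal{E})$ with $\mathcal{E}$ an egg of $\mathrm{PG}(4n-1,q)$. An ovoid of $\mathrm{PG}(3,q^n)$ is a set $\mathcal{O}$ of $q^{2n}+1$ points, every three of which span a plane, viewed as an egg of points with its tangent planes; $T_3(\mathcal{O})$ is the generalised quadrangle $T(\mathcal{O})$ obtained by taking $\mathcal{E}=\mathcal{O}$ in the definition of $T(\mathcal{E})$, with parameters $1,2$ in the role of $n,m$ and field $\mathbb{F}_{q^n}$. Explicitly, embed $\mathrm{PG}(3,q^n)$ as a hyperplane in $\mathrm{PG}(4,q^n)$; the points of $T_3(\mathcal{O})$ are (i) the points of $\mathrm{PG}(4,q^n)$ not in $\mathrm{PG}(3,q^n)$, (ii) the $3$-spaces meeting $\mathrm{PG}(3,q^n)$ exactly in the tangent plane to $\mathcal{O}$ at some point of $\mathcal{O}$, (iii) a symbol $(\infty)$; the lines are (a) the lines of $\mathrm{PG}(4,q^n)$ meeting $\mathrm{PG}(3,q^n)$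 exactly in a point of $\mathcal{O}$, (b) the points of $\mathcal{O}$; a point of type (i) is incident with the lines of type (a) through it, a point of type (ii) is incident with the lines of type (a) it contains and the line of type (b) it contains (the point of $\mathcal{O}$ at which its plane is tangent), and $(\infty)$ is incident with all lines of type (b). *)

(* Defs.v *)
From HB Require Import structures.
From mathcomp Require Import all_boot all_order all_algebra all_field.
Set Implicit Arguments.
Unset Strict Implicit.
Unset Printing Implicit Defensive.
Import GRing.Theory.
Local Open Scope ring_scope.

Section FiniteVspace.
Import VectorInternalTheory.
Variables (F : finFieldType) (vT : vectType F).
HB.instance Definition _ := [Countable of {vspace vT} by <:].
HB.instance Definition _ := [Finite of {vspace vT} by <:].
End FiniteVspace.

Record incidence := Incidence {
  point : finType;
  line : finType;
  inc : point -> line -> bool }.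
Arguments inc {i} P L : rename.

Definition is_gq (s t : nat) (G : incidence) : Prop :=
  [/\ (1 < s)%N, (1 < t)%N,
      forall L : line G, #|[set P | inc P L]| = s.+1,
      forall P : point G, #|[set L | inc P L]| = t.+1 &
      forall (P : point G) (L : line G), ~~ inc P L ->
        exists! M : line G, inc P M /\ exists Q : point G, inc Q M /\ inc Q L].

Definition substructure (G : incidence) (PS : {set point G})
    (LS : {set line G}) : incidence :=
  @Incidence {P : point G | P \in PS} {L : line G | L \in LS}
    (fun P L => inc (val P) (val L)).

Definition is_subquadrangle (s t : nat) (G : incidence) (PS : {set point G})
    (LS : {set line G}) : Prop :=
  is_gq s t (substructure PS LS).

Definition is_isomorphism (G H : incidence) (f : point G -> point H)
    (g : line G -> line H) : Prop :=
  [/\ bijective f, bijective g & forall P L, inc (f P) (g L) = inc P L].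

Definition isomorphic (G H : incidence) : Prop :=
  exists f g, @is_isomorphism G H f g.

(* Throughout, q is #|F|, PG(r, q) is the lattice of subspaces of             *)
(* 'rV[F]_(r + 1), and a projective k-space has \dim equal to k + 1.          *)

Section Egg.
Variables (F : finFieldType) (n m : nat).
Implicit Type E : {set {vspace 'rV[F]_(2 * n + m)}}.
Implicit Types A U : {vspace 'rV[F]_(2 * n + m)}.

Definition is_tangent E A U : bool :=
  [&& \dim U == (n + m)%N, (A <= U)%VS &
      [forall B in E, (B != A) ==> (U :&: B == 0)%VS]].

Definition is_egg E : Prop :=
  [/\ #|E| = ((#|F| ^ m).+1)%N,
      forall A, A \in E -> \dim A = n,
      forall A B C, A \in E -> B \in E -> C \in E ->
        A != B -> A != C -> B != C -> \dim (A + B + C) = (3 * n)%N &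
      forall A, A \in E -> exists U, is_tangent E A U].

End Egg.

Section Embedding.
Variables (F : finFieldType) (k : nat).

Definition embed (v : 'rV[F]_k) : 'rV[F]_(k + 1) := row_mx v 0.

Fact embed_is_linear : linear embed.
Proof. by move=> a u v; rewrite /embed scale_row_mx add_row_mx scaler0 addr0. Qed.
HB.instance Definition _ :=
  GRing.isLinear.Build F 'rV[F]_k 'rV[F]_(k + 1) *:%R embed embed_is_linear.

Definition at_infinity (U : {vspace 'rV[F]_k}) : {vspace 'rV[F]_(k + 1)} :=
  (linfun embed @: U)%VS.

Definition hyperplane_infinity : {vspace 'rV[F]_(k + 1)} := at_infinity fullv.

End Embedding.

Section TE.
Variables (F : finFieldType) (n m : nat).
Variable E : {set {vspace 'rV[F]_(2 * n + m)}}.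
Local Notation W := 'rV[F]_(2 * n + m + 1).
Local Notation Sinf := (@hyperplane_infinity F (2 * n + m)).

Definition affine_point : finType :=
  {P : {vspace W} | (\dim P == 1%N) && ~~ (P <= Sinf)%VS}.

(* The tangent space of an egg at an element is unique, so that quantifying   *)
(* over U amounts to taking U to be the tangent space at A.                   *)
Definition tangent_point : finType :=
  {X : {vspace W} | (\dim X == (n + m).+1) &&
     [exists A in E, exists U, is_tangent E A U &&
        (X :&: Sinf == at_infinity U)%VS]}.

(* None is the symbol (oo). *)
Definition TE_point : finType := option (affine_point + tangent_point).

Definition affine_line : finType :=
  {L : {vspace W} | (\dim L == n.+1) &&
     [exists A in E, (L :&: Sinf == at_infinity A)%VS]}.

Definition egg_line : finType := {A : {vspace 'rV[F]_(2 * n + m)} | A \in E}.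

Definition TE_line : finType := (affine_line + egg_line)%type.

Definition TE_inc (P : TE_point) (L : TE_line) : bool :=
  match P, L with
  | Some (inl P), inl L => (val P <= val L)%VS
  | Some (inl _), inr _ => false
  | Some (inr X), inl L => (val L <= val X)%VS
  | Some (inr X), inr A => (at_infinity (val A) <= val X)%VS
  | None, inl _ => false
  | None, inr _ => true
  end.

Definition TE : incidence := Incidence TE_inc.
Definition base_point : point TE := None.

End TE.

Definition is_tgq (F : finFieldType) (n m : nat) (T : incidence)
    (P0 : point T) : Prop :=
  exists E : {set {vspace 'rV[F]_(2 * n + m)}}, is_egg E /\
  exists (f : point T -> point (TE E)) (g : line T -> line (TE E)),
    is_isomorphism f g /\ f P0 = base_point E.

(* For (n, m) = (1, 2) an egg is a set of #|K|^2 + 1 points of PG(3, K), any  *)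
(* three of which span a plane, each of them lying on a tangent plane.        *)
Definition is_ovoid (K : finFieldType)
    (O : {set {vspace 'rV[K]_(2 * 1 + 2)}}) : Prop := is_egg O.

Definition T3 (K : finFieldType) (O : {set {vspace 'rV[K]_(2 * 1 + 2)}}) :
  incidence := TE O.

(* Main.v *)
(* Write s = q^n and V for the vector space of dimension 4n underlying the egg E.
   A subquadrangle of order s through three lines at the base point contains,
   with each of its affine points v, the coset v + A for all its s + 1 lines A at
   the base point; it has at most s^3 affine points, so these s + 1 egg elements
   lie in the 3n-space spanned by any three of them.  Hence E is good at the two
   elements A1, A2 given by l1, l2: modulo A1 the elements of E are the affine
   elements of a spread, any two of which span a 2n-space that is a union of
   spread elements.  (The planes through both A1 and A2 are not covered by the
   hypothesis; a point of such a plane lies on a plane that is.)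
   Such a normal spread is Desarguesian: in coordinates adapted to a frame, the
   slopes M of its elements y = x M form a set of matrices closed under sums and
   products whose nonzero members are invertible, that is a finite field, by
   Wedderburn's theorem.  The spreads modulo A1 and modulo A2 have the same slopes,
   as both can be read off from E modulo A1 + A2.  The resulting field K of order s
   acts on V and stabilises X + A1 and X + A2, hence their intersection X, for each X
   in E.  It stabilises the tangent spaces too, because the tangent space at A is the
   complement of the union of the sets (X + A) \ A.  So E is an ovoid of PG(3, K). *)
From HB Require Import structures.
Require Import Defs.
From mathcomp Require Import all_boot all_order all_algebra all_field.
From mathcomp Require Import zify.
Set Implicit Arguments.
Unset Strict Implicit.
Unset Printing Implicit Defensive.
Import GRing.Theory.
Local Open Scope ring_scope.

(* lia does not know that \dim is nonnegative, because its codomain is a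
   structure projection that only unfolds to nat. *)
Ltac dlia :=
  intros;
  repeat match goal with
    | H : is_true (leq _ _) |- _ => revert H
    | H : @eq nat _ _ |- _ => revert H
  end;
  repeat match goal with
    |- context [@dimv ?K ?vT ?U] => move: (@dimv K vT U : nat) => ?
  end; clear; rewrite -?[@eq _ _ _]/(@eq nat _ _);
  intros; lia.

(** * Coverings by counting, and dimensions over a finite field *)

Lemma disjoint_cover (I T : finType) (D : {set I}) (B : I -> {set T})
    (P : {set T}) :
  {in D &, forall i j, i != j -> [disjoint B i & B j]} ->
  (forall i, i \in D -> B i \subset P) ->
  (#|P| <= \sum_(i in D) #|B i|)%N ->
  forall v, v \in P -> exists2 i, i \in D & v \in B i.
Proof.
move=> disB subB leP v vP.
(* The family is made empty outside [D], so that it is disjoint over the whole index type, as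
   [partition_disjoint_bigcup] requires. *)
pose C i := if i \in D then B i else set0.
have disC i j : i != j -> [disjoint C i & C j].
  rewrite /C; case: ifP => [iD|_]; last by rewrite disjoints_subset sub0set.
  case: ifP => [jD /disB->//|_ _].
  by rewrite disjoint_sym disjoints_subset sub0set.
have sumC : (\sum_(i in D) #|B i| = #|\bigcup_i C i|)%N.
  rewrite -sum1_card partition_disjoint_bigcup //= big_mkcond /=.
  by apply: eq_bigr => i _; rewrite sum1_card /C; case: ifP; rewrite ?cards0.
have CsubP : \bigcup_i C i \subset P.
  by apply/bigcupsP => i _; rewrite /C; case: ifP => [/subB|_]; rewrite ?sub0set.
have /eqP eqP' : \bigcup_i C i == P by rewrite eqEcard CsubP -sumC.
move: vP; rewrite -eqP' => /bigcupP[i _]; rewrite /C; case: ifP => // iD vi.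
  by exists i.
by rewrite inE in vi.
Qed.

Section FiniteSubspaces.
Variables (F : finFieldType) (k : nat).
Implicit Types U V : {vspace 'rV[F]_k}.

Lemma card_subspace U : #|U| = (#|F| ^ \dim U)%N.
Proof. exact: card_vspace. Qed.

Lemma card_subspace_set U : #|[set v in U]| = (#|F| ^ \dim U)%N.
Proof. by rewrite cardsE card_subspace. Qed.

Lemma card_subspace_diff U V :
  (U <= V)%VS -> #|[set v in V | v \notin U]| = (#|F| ^ \dim V - #|F| ^ \dim U)%N.
Proof.
move=> /subvP UV; have -> : [set v in V | v \notin U] = [set v in V] :\: [set v in U].
  by apply/setP => v; rewrite !inE andbC.
rewrite cardsD (setIidPr _); last by apply/subsetP => v; rewrite !inE; apply: UV.
by rewrite !card_subspace_set.
Qed.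

Lemma vs_capP U V : (forall v, v \in U -> v \in V -> v = 0) -> (U :&: V)%VS = 0%VS.
Proof.
move=> H; apply/eqP; rewrite -subv0; apply/subvP => v; rewrite memv_cap memv0.
by case/andP => vU vV; rewrite (H v).
Qed.

Lemma dim_cap_ge U V : (\dim U + \dim V <= \dim (U :&: V) + k)%N.
Proof.
rewrite -dimv_sum_cap addnC leq_add2l.
by have := dimvS (subvf (U + V)); rewrite dimvf /dim /= mul1n.
Qed.

End FiniteSubspaces.

(** * Eggs and their tangent spaces *)

Section Eggs.
Variables (F : finFieldType) (n m : nat).
Variable E : {set {vspace 'rV[F]_(2 * n + m)}}.
Hypotheses (n_gt0 : (0 < n)%N) (m_gt0 : (0 < m)%N) (eggE : is_egg E).
Local Notation q := #|F|.
Implicit Types A B X Y Z U P : {vspace 'rV[F]_(2 * n + m)}.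

Lemma egg_dim A : A \in E -> \dim A = n :> nat.
Proof. by case: eggE => _ H _ _; apply: H. Qed.

Lemma egg_dim3 A B C : A \in E -> B \in E -> C \in E ->
  A != B -> A != C -> B != C -> \dim (A + B + C) = (3 * n)%N :> nat.
Proof. by case: eggE => _ _ H _; apply: H. Qed.

Lemma egg_third A B : exists2 C, C \in E & (C != A) && (C != B).
Proof.
have : (0 < #|E :\: [set A; B]|)%N.
  rewrite cardsD subn_gt0; case: eggE => -> _ _ _.
  apply: (@leq_ltn_trans 2); first by rewrite (leq_trans (subset_leq_card (subsetIr _ _))) // cards2; case: eqP.
  rewrite ltnS; apply: leq_trans (finNzRing_gt1 F) _.
  by rewrite -{1}[#|F|]expn1 leq_exp2l // finNzRing_gt1.
by case/card_gt0P => C; rewrite !inE negb_or => /andP[? ?]; exists C.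
Qed.

(** A third element [C] makes [A + B + C] of dimension 3n, which forces the sum of these three
    n-dimensional spaces to be direct. *)
Lemma egg_dim2 A B : A \in E -> B \in E -> A != B -> \dim (A + B) = (2 * n)%N :> nat.
Proof.
move=> AE BE AB; have [C CE /andP[CA CB]] := egg_third A B.
have := egg_dim3 AE BE CE AB; rewrite eq_sym CA eq_sym CB => /(_ isT isT).
have := dimv_sum_cap (A + B) C; have := dimv_sum_cap A B.
rewrite (egg_dim AE) (egg_dim BE) (egg_dim CE) => d1 d2 d3; dlia.
Qed.

Lemma egg_cap A B : A \in E -> B \in E -> A != B -> (A :&: B)%VS = 0%VS.
Proof.
move=> AE BE AB; apply/eqP; rewrite -dimv_eq0.
have := dimv_sum_cap A B; rewrite (egg_dim2 AE BE) // (egg_dim AE) (egg_dim BE); dlia.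
Qed.

Lemma egg_cap3 A B C : A \in E -> B \in E -> C \in E ->
  A != B -> A != C -> B != C -> ((A + B) :&: C)%VS = 0%VS.
Proof.
move=> AE BE CE AB AC BC; apply/eqP; rewrite -dimv_eq0.
have := dimv_sum_cap (A + B) C.
rewrite (egg_dim3 AE BE CE) // (egg_dim2 AE BE) // (egg_dim CE); dlia.
Qed.

Lemma egg_neq0 A : A \in E -> exists2 v, v \in A & v != 0.
Proof.
move=> AE; exists (vpick A); first exact: memv_pick.
by rewrite vpick0 -dimv_eq0 egg_dim // -lt0n.
Qed.

(** The [X]-component of a common vector lies in [Y + A], which meets [X] in 0 as soon as [X != Y].
    So the sets [(X + A) \ A] are pairwise disjoint. *)
Lemma egg_cap_rel A X Y v : A \in E -> X \in E -> Y \in E -> X != A -> Y != A ->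
  v \in (X + A)%VS -> v \in (Y + A)%VS -> v \notin A -> X = Y.
Proof.
move=> AE XE YE XA YA /memv_addP[x xX [a aA ->]] /memv_addP[y yY [b bA eq_v]] xa.
apply: contraNeq xa => XY.
have xD : x = y + (b - a) by rewrite addrA -eq_v addrK.
suff -> : x = 0 by rewrite add0r.
apply/eqP; rewrite -memv0 -(egg_cap3 YE AE XE) // 1?eq_sym // memv_cap xX andbT xD.
by rewrite memv_add // rpredB.
Qed.

Section Tangent.
Variables A U : {vspace 'rV[F]_(2 * n + m)}.
Hypotheses (AE : A \in E) (tgU : is_tangent E A U).

Lemma tangent_dim : \dim U = (n + m)%N :> nat.
Proof. by case/and3P: tgU => /eqP. Qed.

Lemma tangent_sub : (A <= U)%VS.
Proof. by case/and3P: tgU. Qed.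

Lemma tangent_cap X : X \in E -> X != A -> (U :&: X)%VS = 0%VS.
Proof. by case/and3P: tgU => _ _ /forall_inP/(_ X) H /H/implyP{}H /H/eqP. Qed.

Lemma tangent_cap_rel X v : X \in E -> X != A ->
  v \in U -> v \in (X + A)%VS -> v \in A.
Proof.
move=> XE XA vU /memv_addP[x xX [a aA vE]].
suff x0 : x = 0 by rewrite vE x0 add0r.
apply/eqP; rewrite -memv0 -(tangent_cap XE XA) memv_cap xX andbT.
have -> : x = v - a by rewrite vE addrK.
by rewrite rpredB // (subvP tangent_sub).
Qed.

(* The disjoint sets (X + A) \ A, for X in D, are large enough to fill P \ U. *)
Lemma egg_cover_sub P (D : {set {vspace 'rV[F]_(2 * n + m)}}) :
  (A <= P)%VS -> (forall X, X \in D -> [/\ X \in E, X != A & (X <= P)%VS]) ->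
  (q ^ \dim P <= #|D| * (q ^ (2 * n) - q ^ n) + q ^ \dim (P :&: U)%VS)%N ->
  forall v, v \in P -> v \notin U -> exists2 X, X \in D & v \in (X + A)%VS.
Proof.
move=> AP HD leD v vP vU.
pose B X := [set v in (X + A)%VS | v \notin A].
have [||||X XD] := @disjoint_cover _ _ D B [set v in P | v \notin (P :&: U)%VS] _ _ _ v.
- move=> X Y XD YD XY; have [XE XA _] := HD X XD; have [YE YA _] := HD Y YD.
  rewrite disjoint_subset; apply/subsetP => w; rewrite !inE => /andP[wX wA].
  rewrite wA andbT; apply: contra XY => wY; apply/eqP.
  exact: (egg_cap_rel AE XE YE XA YA wX wY wA).
- move=> X XD; have [XE XA XP] := HD X XD; apply/subsetP => w; rewrite !inE memv_cap.
  case/andP=> wX wA.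
  have wP : w \in P by move: w wX {wA}; apply/subvP; rewrite subv_add XP.
  rewrite wP /=; apply: contra wA => wU.
  exact: (tangent_cap_rel XE XA).
- rewrite card_subspace_diff ?capvSl // (eq_bigr (fun=> q ^ (2 * n) - q ^ n)%N).
    by rewrite sum_nat_const leq_subLR [leqRHS]addnC.
  move=> X XD; have [XE XA _] := HD X XD.
  by rewrite card_subspace_diff ?addvSr // egg_dim2 // egg_dim.
- by rewrite !inE memv_cap vP.
by rewrite inE => /andP[vX _]; exists X.
Qed.

(** The count is exact: q^m sets of q^(2n) - q^n vectors each, against q^(2n+m) - q^(n+m) vectors
    outside [U]. *)
Lemma egg_cover v :
  v \notin U -> exists2 X, X \in E & (X != A) && (v \in (X + A)%VS).
Proof.
move=> vU.
have [|||||X] := @egg_cover_sub fullv (E :\ A) _ _ _ v; rewrite ?subvf ?memvf //.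
- by move=> X; rewrite !inE subvf => /andP[].
- have -> : #|E :\ A| = (q ^ m)%N.
    by have := cardsD1 A E; rewrite AE; case: eggE => -> _ _ _ [->].
  rewrite capfv tangent_dim dimvf /dim /= mul1n mulnBr -!expnD.
  rewrite (addnC m (2 * n)%N) (addnC m n) subnK // leq_exp2l ?finNzRing_gt1 //; dlia.
by rewrite !inE => /andP[XA XE] vX; exists X; rewrite ?XA.
Qed.

End Tangent.

Lemma tangent_inj A U U' : A \in E -> is_tangent E A U -> is_tangent E A U' -> U = U'.
Proof.
move=> AE tgU tgU'; apply/eqP; rewrite eqEdim (tangent_dim tgU) (tangent_dim tgU').
rewrite leqnn andbT; apply/subvP => u uU; apply: contraT => uU'.
have [X XE /andP[XA uX]] := egg_cover AE tgU' uU'.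
by rewrite (subvP (tangent_sub tgU') _ (tangent_cap_rel tgU XE XA uU uX)) in uU'.
Qed.

(** Meant for [P] of dimension 3n through an element [A]: q^n elements other than [A] are just
    enough to cover [P] outside the tangent space at [A]. *)
Definition rich P := (q ^ n < #|[set X in E | (X <= P)%VS]|)%N.

Lemma rich_cover A U P v : A \in E -> is_tangent E A U -> (A <= P)%VS ->
  \dim P = (3 * n)%N :> nat -> rich P -> v \in P -> v \notin U ->
  exists2 X, X \in E & [&& X != A, (X <= P)%VS & v \in (X + A)%VS].
Proof.
move=> AE tgU AP dP richP vP vU.
have [|||X] := @egg_cover_sub A U AE tgU P [set X in E | (X != A) && (X <= P)%VS] _ _ _ v vP vU.
- by [].
- by move=> X; rewrite inE => /and3P[].
- have : (q ^ n <= #|[set X in E | (X != A) && (X <= P)%VS]|)%N.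
    move: richP; rewrite /rich (cardsD1 A) inE AE AP ltnS; congr leq.
    by apply: eq_card => X; rewrite !inE andbCA.
  (* The dimension formula gives [P :&: U] dimension at least 2n, and q^n (q^(2n) - q^n) + q^(2n) =
     q^(3n). *)
  move=> leD; apply: leq_trans (_ : _ <= q ^ n * (q ^ (2 * n) - q ^ n) + q ^ (2 * n))%N _.
    rewrite dP mulnBr -!expnD (_ : n + 2 * n = 3 * n)%N ?addnn ?mul2n; dlia.
  rewrite leq_add ?leq_mul2r ?leD ?orbT // leq_exp2l ?finNzRing_gt1 //.
  have := dim_cap_ge P U; rewrite dP (tangent_dim tgU); dlia.
by rewrite inE => /and3P[XE XA XP] vX; exists X; rewrite // XA XP.
Qed.

(** The vector [v] is outside the tangent space, so it is covered by some [Y + A] with [Y] in [P],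
    and disjointness gives [Y = X]. *)
Lemma rich_sub A P X v : A \in E -> (A <= P)%VS -> \dim P = (3 * n)%N :> nat -> rich P ->
  X \in E -> X != A -> v \in P -> v \in (X + A)%VS -> v \notin A -> (X <= P)%VS.
Proof.
move=> AE AP dP richP XE XA vP vX vA.
have [U tgU] : exists U, is_tangent E A U by case: eggE => _ _ _; apply.
have vU : v \notin U by apply: contra vA => vU; apply: (tangent_cap_rel tgU XE XA).
have [Y YE /and3P[YA YP vY]] := rich_cover AE tgU AP dP richP vP vU.
by rewrite (egg_cap_rel AE XE YE XA YA vX vY vA).
Qed.

(** At least 2n by the dimension formula; at most 2n because an [X] in [P] provides a 2n-space
    [X + A] of [P] that meets [U] only in [A]. *)
Lemma rich_cap_tangent A U P : A \in E -> is_tangent E A U -> (A <= P)%VS ->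
  \dim P = (3 * n)%N :> nat -> rich P -> \dim (P :&: U)%VS = (2 * n)%N :> nat.
Proof.
move=> AE tgU AP dP richP; have := dim_cap_ge P U; rewrite dP (tangent_dim tgU).
have [X /[!inE]/and3P[XA XE XP]] : exists X, X \in [set X in E | (X <= P)%VS] :\ A.
  apply/card_gt0P; move: richP; rewrite /rich (cardsD1 A) inE AE AP ltnS.
  by apply: leq_trans; rewrite expn_gt0 (ltnW (finNzRing_gt1 F)).
have := dimv_sum_cap (P :&: U) (X + A); rewrite (egg_dim2 XE AE XA).
have : (\dim ((P :&: U) + (X + A)) <= \dim P)%N.
  by rewrite dimvS // subv_add capvSl subv_add XP.
have : (\dim ((P :&: U) :&: (X + A)) <= \dim A)%N.
  apply/dimvS/subvP => w; rewrite !memv_cap => /andP[/andP[_ wU] wX].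
  exact: (tangent_cap_rel tgU XE XA).
rewrite dP (egg_dim AE); dlia.
Qed.

End Eggs.
(* A spread of the quotient of V by A, whose elements (D) and planes (P) are
   represented by their preimages in V. *)
Record normal_spread (F : finFieldType) (n k : nat) (A : {vspace 'rV[F]_k})
    (D P : {vspace 'rV[F]_k} -> Prop) : Prop := NormalSpread {
  spread_dim : forall Y, D Y -> \dim Y = (2 * n)%N :> nat;
  spread_sub : forall Y, D Y -> (A <= Y)%VS;
  spread_pdim : forall Q, P Q -> \dim Q = (3 * n)%N :> nat;
  spread_cover : forall v, exists2 Y, D Y & v \in Y;
  spread_eq : forall Y Y' v, D Y -> D Y' -> v \notin A -> v \in Y -> v \in Y' -> Y = Y';
  spread_join : forall Y Y', D Y -> D Y' -> exists2 Q, P Q & (Y <= Q)%VS && (Y' <= Q)%VS;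
  spread_plane : forall Y Q v, D Y -> P Q -> v \notin A -> v \in Y -> v \in Q -> (Y <= Q)%VS }.

(** * Good elements *)

Section GoodElements.
Variables (F : finFieldType) (n : nat).
Variable E : {set {vspace 'rV[F]_(2 * n + 2 * n)}}.
Hypotheses (n_gt0 : (0 < n)%N) (eggE : is_egg E).
Local Notation q := #|F|.
Implicit Types A B X Y Z U P : {vspace 'rV[F]_(2 * n + 2 * n)}.

Let m_gt0 : (0 < 2 * n)%N. Proof. by rewrite muln_gt0. Qed.

(** The usual notion of an egg that is good at [A], with the exact number q^n + 1 of elements
    replaced by a lower bound. *)
Definition good A := forall X Y, X \in E -> Y \in E -> X != A -> Y != A -> X != Y ->
  rich E (A + X + Y)%VS.

(** As [U] is skew from [X], at most one [y] in [X] puts [u + y] in [U]; a third vector of [X]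
    avoids both this [y] and 0. *)
Lemma tangent_avoid A U X : A \in E -> is_tangent E A U -> X \in E -> X != A ->
  (2 < q ^ n)%N -> forall u, exists2 y, y \in X & (y != 0) && (u + y \notin U).
Proof.
move=> AE tgU XE XA q_gt2 u.
have [y0 y0X y00] := egg_neq0 n_gt0 eggE XE.
have [uy0|uy0] := boolP (u + y0 \in U); last by exists y0; rewrite // y00.
have : (0 < #|[set y in X] :\: [set 0%R; y0]|)%N.
  rewrite cardsD subn_gt0 card_subspace_set (egg_dim eggE XE).
  apply: leq_ltn_trans q_gt2; rewrite (leq_trans (subset_leq_card (subsetIr _ _))) //.
  by rewrite cards2; case: eqP.
case/card_gt0P => y1; rewrite !inE negb_or => /andP[/andP[y1n0 y10] y1X].
exists y1; rewrite // y1n0; apply: contra y10 => uy1; rewrite -subr_eq0 -memv0.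
rewrite -(tangent_cap tgU XE XA) memv_cap (rpredB y1X) // andbT.
by have := rpredB uy1 uy0; rewrite opprD addrACA subrr add0r.
Qed.

(** The planes [A + B + X] remain. Such a plane contains a vector [u + y] outside [U], with [u] in
    [B] and [y] in [X]. The element [Z] that covers it modulo [A] differs from [B] and [X], so
    [A + X + Z] is rich by hypothesis. This plane contains [u], hence [B] by [rich_sub], and so
    equals [A + B + X]. *)
Lemma good_of_exception A B : A \in E -> B \in E -> A != B -> (2 < q ^ n)%N ->
  (forall X Y, X \in E -> Y \in E -> X != A -> Y != A -> X != B -> Y != B ->
     X != Y -> rich E (A + X + Y)%VS) ->
  good A.
Proof.
move=> AE BE AB q_gt2 HB.
suff richB X : X \in E -> X != A -> X != B -> rich E (A + B + X)%VS.
  move=> X Y XE YE XA YA XY.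
  have [XB|XB] := eqVneq X B; first by rewrite XB richB // -XB eq_sym.
  have [YB|YB] := eqVneq Y B; last exact: HB.
  by rewrite YB -addvA (addvC X) addvA richB.
move=> XE XA XB; have [U tgU] : exists U, is_tangent E A U by case: eggE => _ _ _; apply.
have [u uB u0] := egg_neq0 n_gt0 eggE BE.
have [y yX /andP[y0 uyU]] := tangent_avoid AE tgU XE XA q_gt2 u.
have [Z ZE /andP[ZA uyZ]] := egg_cover n_gt0 m_gt0 eggE AE tgU uyU.
have uE : u = (u + y) - y by rewrite addrK.
have yE : y = (u + y) - u by rewrite addrC addKr.
have ZB : Z != B.
  apply: contraNneq y0 => ZB; rewrite -memv0.
  rewrite -(egg_cap3 n_gt0 m_gt0 eggE AE BE XE) // 1?eq_sym // memv_cap yX andbT yE.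
  by rewrite rpredB // ?(subvP (addvSr _ _) u) // addvC -ZB.
have XZ : X != Z.
  apply: contraNneq u0 => XZ; rewrite -memv0.
  rewrite -(egg_cap3 n_gt0 m_gt0 eggE AE XE BE) // 1?eq_sym // memv_cap uB andbT uE.
  by rewrite rpredB // ?(subvP (addvSr _ _) y) // addvC XZ.
have richQ : rich E (A + X + Z)%VS by apply: HB.
have dQ : \dim (A + X + Z) = (3 * n)%N :> nat by rewrite (egg_dim3 eggE) // eq_sym.
have uQ : u \in (A + X + Z)%VS.
  rewrite uE rpredB //; last by rewrite (subvP (addvSl _ _)) // (subvP (addvSr _ _)).
  by move: uyZ; apply/subvP; rewrite addvC addvS ?addvSl.
have AQ : (A <= A + X + Z)%VS by rewrite -addvA addvSl.
have uA : u \notin A by apply: contra u0 => uA; rewrite -memv0 -(egg_cap n_gt0 m_gt0 eggE AE BE AB) memv_cap uA.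
have BQ : (B <= A + X + Z)%VS.
  apply: (rich_sub n_gt0 m_gt0 eggE AE AQ dQ richQ BE _ uQ _ uA); first by rewrite eq_sym.
  by rewrite (subvP (addvSl _ _)).
suff -> : (A + B + X = A + X + Z)%VS by [].
apply/eqP; rewrite eqEdim dQ (egg_dim3 eggE) // 1?eq_sym // leqnn andbT.
by rewrite !subv_add AQ BQ (subv_trans (addvSr A X)) ?addvSl.
Qed.

(** A nonzero vector of [X] moves [v] out of [U], where [egg_cover] applies. Thus [v] lies in a
    plane [A + X + Z] through a prescribed [X]; this is how vectors of the tangent space are
    reached. *)
Lemma tangent_shift A U X v : A \in E -> is_tangent E A U -> X \in E -> X != A ->
  v \in U -> v \notin A ->
  exists x Z, [/\ x \in X, v + x \notin U, v + x \in (Z + A)%VS &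
    [/\ Z \in E, Z != A & X != Z]].
Proof.
move=> AE tgU XE XA vU vA; have [x xX x0] := egg_neq0 n_gt0 eggE XE.
have vxU : v + x \notin U.
  apply: contra x0 => vxU; rewrite -memv0 -(tangent_cap tgU XE XA) memv_cap xX andbT.
  by rewrite -[x](addKr v) addrC rpredB.
have [Z ZE /andP[ZA vxZ]] := egg_cover n_gt0 m_gt0 eggE AE tgU vxU.
exists x, Z; split => //; split => //; apply: contraNneq vA => XZ.
apply: (tangent_cap_rel tgU XE XA vU).
by rewrite -[v](addrK x) rpredB // XZ // -XZ (subvP (addvSl _ _)).
Qed.

Section Spread.
Variables A U : {vspace 'rV[F]_(2 * n + 2 * n)}.
Hypotheses (AE : A \in E) (goodA : good A) (tgU : is_tangent E A U).

Definition affine_plane P := exists X Y,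
  [/\ X \in E, Y \in E, X != A, Y != A & X != Y] /\ P = (A + X + Y)%VS.

Lemma affine_planeP P : affine_plane P ->
  [/\ \dim P = (3 * n)%N :> nat, (A <= P)%VS & rich E P].
Proof.
move=> [X [Y [[XE YE XA YA XY] ->]]]; split; last exact: goodA.
  by rewrite (egg_dim3 eggE) // eq_sym.
by rewrite -addvA addvSl.
Qed.

Lemma affine_plane_eq P P' : affine_plane P -> affine_plane P' -> (P <= P')%VS -> P = P'.
Proof.
move=> /affine_planeP[dP _ _] /affine_planeP[dP' _ _] PP'.
by apply/eqP; rewrite eqEdim PP' dP dP' leqnn.
Qed.

(** Either [P :&: P'] lies in [U] and, being of dimension at least 2n, is the trace of both planes
    on [U]; or it has a vector outside [U], which gives a common element [X], and shifting [v] along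
    [X] gives a second one, so that [P = P']. *)
Lemma affine_plane_tangent P P' v : affine_plane P -> affine_plane P' ->
  v \in P -> v \in P' -> v \in U -> v \notin A -> (P :&: U = P' :&: U)%VS.
Proof.
move=> affP affP' vP vP' vU vA.
have [dP AP richP] := affine_planeP affP; have [dP' AP' richP'] := affine_planeP affP'.
have [PPU|] := boolP (P :&: P' <= U)%VS.
  have cap_eq Q : \dim (Q :&: U)%VS = (2 * n)%N :> nat -> (P :&: P' <= Q)%VS ->
    (P :&: P' = Q :&: U)%VS.
    move=> dQ PQ; apply/eqP; rewrite eqEdim subv_cap PPU PQ dQ.
    by have := dim_cap_ge P P'; rewrite dP dP'; dlia.
  rewrite -(cap_eq P) ?capvSl ?(rich_cap_tangent n_gt0 m_gt0 eggE AE tgU) //.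
  by rewrite -(cap_eq P') ?capvSr ?(rich_cap_tangent n_gt0 m_gt0 eggE AE tgU).
case/subvPn => w; rewrite memv_cap => /andP[wP wP'] wU.
have wA : w \notin A by apply: contra wU; apply/subvP/(tangent_sub tgU).
have [X XE /and3P[XA XP wX]] := rich_cover n_gt0 m_gt0 eggE AE tgU AP dP richP wP wU.
have XP' := rich_sub n_gt0 m_gt0 eggE AE AP' dP' richP' XE XA wP' wX wA.
have [x [Z [xX vxU vxZ [ZE ZA XZ]]]] := tangent_shift AE tgU XE XA vU vA.
have vxA : v + x \notin A by apply: contra vxU; apply/subvP/(tangent_sub tgU).
have ZP : (Z <= P)%VS.
  by apply: (rich_sub n_gt0 m_gt0 eggE AE AP dP richP ZE ZA _ vxZ vxA); rewrite rpredD // (subvP XP).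
have ZP' : (Z <= P')%VS.
  by apply: (rich_sub n_gt0 m_gt0 eggE AE AP' dP' richP' ZE ZA _ vxZ vxA); rewrite rpredD // (subvP XP').
have affQ : affine_plane (A + X + Z) by exists X, Z.
have -> : P = (A + X + Z)%VS.
  by apply/esym/(affine_plane_eq affQ affP); rewrite !subv_add AP XP.
have -> : P' = (A + X + Z)%VS.
  by apply/esym/(affine_plane_eq affQ affP'); rewrite !subv_add AP' XP'.
by [].
Qed.

(* The second kind of element is at infinity, inside the tangent space U. *)
Definition spread_elt Y := (exists2 X, X \in E & X != A /\ Y = (X + A)%VS) \/
  (exists2 P, affine_plane P & Y = (P :&: U)%VS).

Definition spread_pln P := P = U \/ affine_plane P.

(** The spread elements are the points of a projective plane whose lines are the planes of the
    spread: the [X + A] are its affine points, the traces on [U] its points at infinity, and [U], of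
    dimension n + 2n = 3n, its line at infinity. *)
Lemma good_spread : normal_spread n A spread_elt spread_pln.
Proof.
have sUA : (A <= U)%VS := tangent_sub tgU.
split.
- move=> _ [[X XE [XA ->]]|[P affP ->]]; first exact: (egg_dim2 n_gt0 m_gt0 eggE).
  have [dP AP richP] := affine_planeP affP.
  exact: (rich_cap_tangent n_gt0 m_gt0 eggE AE).
- move=> _ [[X XE [XA ->]]|[P /affine_planeP[_ AP _] ->]]; first exact: addvSr.
  by rewrite subv_cap AP.
- move=> P [->|/affine_planeP[]//]; rewrite (tangent_dim tgU); lia.
- move=> v; have [vU|vU] := boolP (v \in U); last first.
    have [X XE /andP[XA vX]] := egg_cover n_gt0 m_gt0 eggE AE tgU vU.
    by exists (X + A)%VS => //; left; exists X.
  have [X XE /andP[XA _]] := egg_third m_gt0 eggE A A.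
  have [vA|vA] := boolP (v \in A).
    exists (X + A)%VS; first by left; exists X.
    by rewrite (subvP (addvSr _ _)).
  have [x [Z [xX vxU vxZ [ZE ZA XZ]]]] := tangent_shift AE tgU XE XA vU vA.
  exists ((A + X + Z) :&: U)%VS; first by right; exists (A + X + Z)%VS => //; exists X, Z.
  rewrite memv_cap vU andbT -[v](addrK x) rpredB //.
    by move: vxZ; apply/subvP; rewrite addvC addvS ?addvSl.
  by rewrite (subvP (addvSl _ _)) // (subvP (addvSr _ _)).
- move=> _ _ v [[X XE [XA ->]]|[P affP ->]] [[X' XE' [XA' ->]]|[P' affP' ->]] vA.
  + by move=> vX vX'; rewrite (egg_cap_rel n_gt0 m_gt0 eggE AE XE XE' XA XA' vX vX').
  + move=> vX; rewrite memv_cap => /andP[_ vU].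
    by rewrite (tangent_cap_rel tgU XE XA vU vX) in vA.
  + rewrite memv_cap => /andP[_ vU] vX.
    by rewrite (tangent_cap_rel tgU XE' XA' vU vX) in vA.
  + rewrite !memv_cap => /andP[vP vU] /andP[vP' _].
    exact: (affine_plane_tangent affP affP' vP vP' vU vA).
(* A vector of [P :&: U] outside [A] lies in some [A + X + Z], which then has the same trace on [U]
   as [P]. *)
- have aux X P : X \in E -> X != A -> affine_plane P ->
    exists2 Q, spread_pln Q & (X + A <= Q)%VS && (P :&: U <= Q)%VS.
    move=> XE XA affP; have [dP AP richP] := affine_planeP affP.
    have [|v] := @subvPn _ _ (P :&: U)%VS A _.
      apply/negP => /dimvS.
      by rewrite (rich_cap_tangent n_gt0 m_gt0 eggE AE) // (egg_dim eggE AE); lia.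
    rewrite memv_cap => /andP[vP vU] vA.
    have [x [Z [xX vxU vxZ [ZE ZA XZ]]]] := tangent_shift AE tgU XE XA vU vA.
    have affQ : affine_plane (A + X + Z) by exists X, Z.
    have vQ : v \in (A + X + Z)%VS.
      rewrite -[v](addrK x) rpredB //.
        by move: vxZ; apply/subvP; rewrite addvC addvS ?addvSl.
      by rewrite (subvP (addvSl _ _)) // (subvP (addvSr _ _)).
    exists (A + X + Z)%VS; first by right.
    by rewrite (addvC X) addvSl (affine_plane_tangent affP affQ vP vQ vU vA) capvSl.
  move=> _ _ [[X XE [XA ->]]|[P affP ->]] [[X' XE' [XA' ->]]|[P' affP' ->]].
  + have [->|XX'] := eqVneq X X'.
      have [Z ZE /andP[ZA ZX]] := egg_third m_gt0 eggE A X'.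
      exists (A + X' + Z)%VS; first by right; exists X', Z; split=> //; split=> //; rewrite eq_sym.
      by rewrite (addvC X') addvSl.
    exists (A + X + X')%VS; first by right; exists X, X'.
    by rewrite !subv_add addvSr (subv_trans (addvSr A X)) ?addvSl // -addvA addvSl.
  + exact: aux.
  + by have [Q QP] := aux _ _ XE' XA' affP; rewrite andbC; exists Q.
  + by exists U; [left | rewrite !capvSr].
- move=> _ P v [[X XE [XA ->]]|[P' affP' ->]] [->|affP] vA.
  + by move=> vX vU; rewrite (tangent_cap_rel tgU XE XA vU vX) in vA.
  + move=> vX vP; have [dP AP richP] := affine_planeP affP.
    by rewrite subv_add AP andbT (rich_sub n_gt0 m_gt0 eggE AE AP dP richP XE XA vP vX).
  + by rewrite capvSr.
  + rewrite memv_cap => /andP[vP' vU] vP.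
    by rewrite (affine_plane_tangent affP' affP vP' vP vU vA) capvSl.
Qed.

End Spread.
End GoodElements.

(** * Slopes of a normal spread *)

Section SpreadCoordinates.
Variables (F : finFieldType) (n' k : nat).
Local Notation n := n'.+1.
Local Notation R := 'rV[F]_n.
Variables (A : {vspace 'rV[F]_k}) (D P : {vspace 'rV[F]_k} -> Prop).
Variables x y z : {linear 'rV[F]_k -> R}.

(** Coordinates on the quotient by [A], in blocks of length n, in which the members of a projective
    frame, three axes and a diagonal, are spread elements. *)
Record spread_frame : Prop := SpreadFrame {
  frame_k : k = (4 * n)%N;
  frame_dim : \dim A = n :> nat;
  frame_spread : normal_spread n A D P;
  frame_mem : forall v, v \in A <-> [/\ x v = 0, y v = 0 & z v = 0];
  frame_onto : forall a b c, exists v, [/\ x v = a, y v = b & z v = c];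
  frame_axisX : exists2 Y, D Y & forall v, v \in Y <-> y v = 0 /\ z v = 0;
  frame_axisY : exists2 Y, D Y & forall v, v \in Y <-> x v = 0 /\ z v = 0;
  frame_axisZ : exists2 Y, D Y & forall v, v \in Y <-> x v = 0 /\ y v = 0;
  frame_diag : exists2 Y, D Y & forall v, x v = y v -> z v = y v -> v \in Y }.

Hypothesis frameD : spread_frame.
Let kE : k = (4 * n)%N. Proof. exact: frame_k frameD. Qed.
Let dimA : \dim A = n :> nat. Proof. exact: frame_dim frameD. Qed.
Let spreadD : normal_spread n A D P. Proof. exact: frame_spread frameD. Qed.
Let memA : forall v, v \in A <-> [/\ x v = 0, y v = 0 & z v = 0]. Proof. exact: frame_mem frameD. Qed.
Let xyz_onto : forall a b c, exists v, [/\ x v = a, y v = b & z v = c]. Proof. exact: frame_onto frameD. Qed.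
Let axisX : exists2 Y, D Y & forall v, v \in Y <-> y v = 0 /\ z v = 0. Proof. exact: frame_axisX frameD. Qed.
Let axisY : exists2 Y, D Y & forall v, v \in Y <-> x v = 0 /\ z v = 0. Proof. exact: frame_axisY frameD. Qed.
Let axisZ : exists2 Y, D Y & forall v, v \in Y <-> x v = 0 /\ y v = 0. Proof. exact: frame_axisZ frameD. Qed.
Let diagD : exists2 Y, D Y & forall v, x v = y v -> z v = y v -> v \in Y. Proof. exact: frame_diag frameD. Qed.

(** Only an inclusion is asked, so that joins and meets can be handled by exhibiting decompositions
    of coordinate triples. *)
Definition elt_has (p : R -> R -> R -> Prop) :=
  exists2 Y, D Y & forall v, p (x v) (y v) (z v) -> v \in Y.
Definition pln_has (p : R -> R -> R -> Prop) :=
  exists2 Q, P Q & forall v, p (x v) (y v) (z v) -> v \in Q.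

Lemma pln_join p p' (r : R -> R -> R -> Prop) : elt_has p -> elt_has p' ->
  (forall a b c, r a b c -> exists a1 b1 c1,
     p a1 b1 c1 /\ p' (a - a1) (b - b1) (c - c1)) ->
  pln_has r.
Proof.
move=> [Y DY pY] [Y' DY' pY'] rP.
have [Q PQ /andP[/subvP YQ /subvP YQ']] := spread_join spreadD DY DY'.
exists Q => // v /rP[a1 [b1 [c1 [p1 p2]]]].
have [v1 [xE yE zE]] := xyz_onto a1 b1 c1.
rewrite -[v](subrK v1) rpredD //.
  by apply/YQ'/pY'; rewrite !linearB xE yE zE.
by apply/YQ/pY; rewrite xE yE zE.
Qed.

Lemma pln_proper Q : P Q -> exists v, v \notin Q.
Proof.
move=> /(spread_pdim spreadD) dQ; have /subvPn[v _ vQ] : ~~ (fullv <= Q)%VS; last by exists v.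
by apply/negP => /dimvS; rewrite dQ dimvf /dim /= mul1n kE; lia.
Qed.

(** The decomposition of every triple makes the two planes distinct. Their intersection has
    dimension at least 2n, so it contains a spread element [Y]; a vector of it outside [Y] would
    give a second such element, and the two would span both planes. *)
Lemma elt_meet r r' (p : R -> R -> R -> Prop) : pln_has r -> pln_has r' ->
  (forall a b c, exists a1 b1 c1, r a1 b1 c1 /\ r' (a - a1) (b - b1) (c - c1)) ->
  (forall a b c, p a b c -> r a b c /\ r' a b c) ->
  elt_has p.
Proof.
move=> [Q PQ rQ] [Q' PQ' rQ'] rr' prr'.
have neqQ : Q <> Q'.
  have [v /negP vQ] := pln_proper PQ; move=> QQ'; apply: vQ.
  have [a1 [b1 [c1 [r1 r2]]]] := rr' (x v) (y v) (z v).
  have [v1 [xE yE zE]] := xyz_onto a1 b1 c1.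
  rewrite -[v](subrK v1) rpredD //; last by apply: rQ; rewrite xE yE zE.
  by rewrite QQ'; apply: rQ'; rewrite !linearB xE yE zE.
have dQ := spread_pdim spreadD PQ; have dQ' := spread_pdim spreadD PQ'.
have /subvPn[u] : ~~ (Q :&: Q' <= A)%VS.
  apply/negP => /dimvS; rewrite dimA => le_n.
  by have := dim_cap_ge Q Q'; move: le_n; rewrite dQ dQ' [X in (_ <= _ + X)%N]kE; dlia.
rewrite memv_cap => /andP[uQ uQ'] uA.
have [Y DY uY] := spread_cover spreadD u.
have YQ := spread_plane spreadD DY PQ uA uY uQ.
have YQ' := spread_plane spreadD DY PQ' uA uY uQ'.
exists Y => // w /prr'[/rQ wQ /rQ' wQ']; apply: contraT => wY; case: neqQ.
have wA : w \notin A by apply: contra wY; apply/subvP/(spread_sub spreadD).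
have [Y' DY' wY'] := spread_cover spreadD w.
have Y'Q := spread_plane spreadD DY' PQ wA wY' wQ.
have Y'Q' := spread_plane spreadD DY' PQ' wA wY' wQ'.
have dYY' : \dim (Y + Y') = (3 * n)%N :> nat.
  have := dimv_sum_cap Y Y'; have := dimvS YQ.
  have : (\dim (Y :&: Y') <= \dim A)%N.
    apply/dimvS/subvP => t; rewrite memv_cap => /andP[tY tY']; apply: contraT => tA.
    by rewrite (spread_eq spreadD DY DY' tA tY tY') wY' in wY.
  have : (\dim (Y + Y') <= \dim Q)%N by rewrite dimvS // subv_add YQ.
  rewrite (spread_dim spreadD DY) (spread_dim spreadD DY') dimA dQ; dlia.
have eqYY' S : (Y <= S)%VS -> (Y' <= S)%VS -> \dim S = (3 * n)%N :> nat -> (Y + Y')%VS = S.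
  by move=> YS Y'S dS; apply/eqP; rewrite eqEdim subv_add YS Y'S dS dYY' leqnn.
by rewrite -(eqYY' Q) // -(eqYY' Q').
Qed.

Lemma eltX : elt_has (fun a b c => b = 0 /\ c = 0).
Proof. by have [Y DY HY] := axisX; exists Y => // v /HY. Qed.
Lemma eltY : elt_has (fun a b c => a = 0 /\ c = 0).
Proof. by have [Y DY HY] := axisY; exists Y => // v /HY. Qed.
Lemma eltZ : elt_has (fun a b c => a = 0 /\ b = 0).
Proof. by have [Y DY HY] := axisZ; exists Y => // v /HY. Qed.
Lemma eltI : elt_has (fun a b c => a = b /\ c = b).
Proof. by have [Y DY HY] := diagD; exists Y => // v []; apply: HY. Qed.

Lemma plnX : pln_has (fun a b c => a = 0).
Proof.
apply: (pln_join eltY eltZ) => a b c ->; exists 0, b, 0.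
by rewrite !subrr.
Qed.
Lemma plnY : pln_has (fun a b c => b = 0).
Proof.
apply: (pln_join eltX eltZ) => a b c ->; exists a, 0, 0.
by rewrite !subrr.
Qed.
Lemma plnZ : pln_has (fun a b c => c = 0).
Proof.
apply: (pln_join eltX eltY) => a b c ->; exists a, 0, 0.
by rewrite !subrr.
Qed.
Lemma pln_xy : pln_has (fun a b c => a = b).
Proof.
apply: (pln_join eltZ eltI) => a b c ->; exists 0, 0, (c - b).
by rewrite !subr0 subKr.
Qed.
Lemma pln_xz : pln_has (fun a b c => c = a).
Proof.
apply: (pln_join eltY eltI) => a b c ->; exists 0, (b - a), 0.
by rewrite !subr0 subKr.
Qed.

(** Coordinates on a line of the projective plane: the points of the line [x = 0] other than the
    z-axis are graphs [z = y M]. *)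
Definition slope (M : 'M[F]_n) := elt_has (fun a b c => a = 0 /\ c = b *m M).

Lemma slope_of_pln M : pln_has (fun a b c => c = b *m M) -> slope M.
Proof.
move=> plnM; apply: (elt_meet plnM plnX) => [a b c|a b c []//].
by exists a, b, (b *m M); rewrite subrr.
Qed.

Lemma slope_pln_yz M : slope M -> pln_has (fun a b c => c = b *m M).
Proof.
move=> sM; apply: (pln_join eltX sM) => a b c ->; exists a, 0, 0.
by rewrite !subr0 subrr.
Qed.

(** The slope is projected from the x-axis onto [x = y], then from the y-axis onto [y = 0]. *)
Lemma slope_xz M : slope M -> elt_has (fun a b c => b = 0 /\ c = a *m M).
Proof.
move=> sM; have e : elt_has (fun a b c => a = b /\ c = b *m M).
  apply: (elt_meet (slope_pln_yz sM) pln_xy) => [a b c|a b c []//].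
  by exists a, b, (b *m M); rewrite !subrr.
have plnM : pln_has (fun a b c => c = a *m M).
  apply: (pln_join eltY e) => a b c ->; exists 0, (b - a), 0.
  by rewrite !subr0 subKr.
apply: (elt_meet plnM plnY) => [a b c|a b c []//].
by exists a, b, (a *m M); rewrite subrr.
Qed.

Lemma slope_pln_xz M : slope M -> pln_has (fun a b c => c = a *m M).
Proof.
move=> sM; apply: (pln_join eltY (slope_xz sM)) => a b c ->; exists 0, b, 0.
by rewrite !subr0 subrr.
Qed.

Lemma slope_pln_xy M : slope M -> pln_has (fun a b c => a = b *m M).
Proof.
move=> sM; have e : elt_has (fun a b c => a = b *m M /\ c = b *m M).
  apply: (elt_meet (slope_pln_yz sM) pln_xz) => [a b c|a b c [-> ->]//].
  by exists (a - (c - b *m M)), b, (b *m M); rewrite subKr.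
apply: (pln_join eltZ e) => a b c ->; exists 0, 0, (c - b *m M).
by rewrite !subr0 subKr.
Qed.

Lemma slope1 : slope 1%:M.
Proof.
apply: slope_of_pln; apply: (pln_join eltX eltI) => a b c; rewrite mulmx1 => ->.
by exists (a - b), 0, 0; rewrite !subr0 subKr.
Qed.

(** The plane [z = x M + y N] joins slope [M] taken in [y = 0] to slope [N] in [x = 0]; its meet
    with [x = y] is projected back from the x-axis. *)
Lemma slopeD M N : slope M -> slope N -> slope (M + N).
Proof.
move=> sM sN; have plnMN : pln_has (fun a b c => c = a *m M + b *m N).
  apply: (pln_join (slope_xz sM) sN) => a b c ->; exists a, 0, (a *m M).
  by rewrite subrr subr0 addrAC subrr add0r.
have e : elt_has (fun a b c => a = b /\ c = b *m (M + N)).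
  apply: (elt_meet plnMN pln_xy) => [a b c|a b c [-> ->]]; last by rewrite mulmxDr.
  by exists a, b, (a *m M + b *m N); rewrite !subrr.
apply: slope_of_pln; apply: (pln_join eltX e) => a b c ->; exists (a - b), 0, 0.
by rewrite !subr0 subKr.
Qed.

(** The planes [x = y M] and [z = x N] meet where [z = y M N]. *)
Lemma slopeM M N : slope M -> slope N -> slope (M *m N).
Proof.
move=> sM sN; have e : elt_has (fun a b c => a = b *m M /\ c = b *m (M *m N)).
  apply: (elt_meet (slope_pln_xy sM) (slope_pln_xz sN)) => [a b c|a b c [-> ->]].
    by exists (b *m M), b, (c - (a - b *m M) *m N); rewrite subKr.
  by rewrite mulmxA.
apply: slope_of_pln; apply: (pln_join eltX e) => a b c ->; exists (a - b *m M), 0, 0.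
by rewrite !subr0 subKr.
Qed.

(** The plane [z = x + y M] cuts [z = 0] where [x = - y M]; the plane [x = z] carries this to the
    coordinate [z]. *)
Lemma slopeN M : slope M -> slope (- M).
Proof.
move=> sM; have plnM : pln_has (fun a b c => c = a + b *m M).
  apply: (pln_join (slope_xz slope1) sM) => a b c ->; exists a, 0, a.
  by rewrite mulmx1 subrr subr0 addrAC subrr add0r.
have e : elt_has (fun a b c => a = b *m (- M) /\ c = 0).
  apply: (elt_meet plnM plnZ) => [a b c|a b c [-> ->]].
    by exists (c - b *m M), b, c; rewrite subrK subrr.
  by rewrite mulmxN addNr.
have e' : elt_has (fun a b c => a = b *m (- M) /\ c = b *m (- M)).
  have plnNM : pln_has (fun a b c => a = b *m (- M)).
    apply: (pln_join eltZ e) => a b c ->; exists 0, 0, c.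
    by rewrite !subr0 subrr.
  apply: (elt_meet plnNM pln_xz) => [a b c|a b c [-> ->]//].
  by exists (b *m (- M)), b, (c - (a - b *m (- M))); rewrite subKr.
apply: slope_of_pln; apply: (pln_join eltX e') => a b c ->; exists (a - b *m (- M)), 0, 0.
by rewrite !subr0 subKr.
Qed.

(** The element of slope [M] shares the vector (0, a, 0) with the y-axis, so it is the y-axis. Hence
    nonzero slopes are invertible, and slopes that agree on a nonzero vector are equal. *)
Lemma slope_inj M (a : R) : slope M -> a != 0 -> a *m M = 0 -> M = 0.
Proof.
move=> [Y DY MY] a0 aM; have [Y' DY' HY'] := axisY.
have [v [xv yv zv]] := xyz_onto 0 a 0.
have vA : v \notin A by apply: contra a0 => /memA[_ <- _]; rewrite yv.
have vY : v \in Y by apply: MY; rewrite xv yv zv aM.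
have vY' : v \in Y' by apply/HY'.
have YY' := spread_eq spreadD DY DY' vA vY vY'.
apply/row_matrixP => i; rewrite row0 rowE.
have [w [xw yw zw]] := xyz_onto 0 (delta_mx 0 i) (delta_mx 0 i *m M).
have : w \in Y' by rewrite -YY'; apply: MY; rewrite xw yw zw.
by case/HY' => _; rewrite zw.
Qed.

(** The spread element [Y] through (0, a, b) lies in the plane [x = 0] and meets the z-axis only in
    [A], so modulo [A] it is a graph over the coordinate [y]. *)
Lemma slope_transitive (a b : R) : a != 0 -> exists2 M, slope M & a *m M = b.
Proof.
move=> a0; have [v [xv yv zv]] := xyz_onto 0 a b.
have vA : v \notin A by apply: contra a0 => /memA[_ <- _]; rewrite yv.
have [Y DY vY] := spread_cover spreadD v.
have [Q PQ HQ] := plnX.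
have YQ := spread_plane spreadD DY PQ vA vY (HQ v xv).
(* [Q] is only known to contain the subspace [x = 0]. A further vector would bring the whole x-axis
   into [Q], which would then be everything. *)
have xY w : w \in Y -> x w = 0.
  move=> /(subvP YQ) wQ; apply/eqP; apply: contraT => xw.
  have [YX DX HX] := axisX; have [w1 [x1 y1 z1]] := xyz_onto 0 (y w) (z w).
  have w2X : w - w1 \in YX by apply/HX; rewrite !linearB y1 z1 !subrr.
  have w2A : w - w1 \notin A.
    by apply: contra xw => /memA[]; rewrite linearB x1 subr0 => ->.
  have w2Q : w - w1 \in Q by rewrite rpredB //; apply: HQ.
  have XQ := spread_plane spreadD DX PQ w2A w2X w2Q.
  have [t /negP[]] := pln_proper PQ.
  have [t1 [xt yt zt]] := xyz_onto 0 (y t) (z t).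
  rewrite -[t](subrK t1) rpredD //; last by apply: HQ.
  by apply/(subvP XQ)/HX; rewrite !linearB yt zt !subrr.
have yY w : w \in Y -> y w = 0 -> w \in A.
  move=> wY yw; apply: contraT => wA; have [YZ DZ HZ] := axisZ.
  have wZ : w \in YZ by apply/HZ; rewrite xY.
  move: vY; rewrite (spread_eq spreadD DY DZ wA wY wZ) => /HZ[_].
  by rewrite yv => /eqP; rewrite (negPf a0).
have AY := spread_sub spreadD DY.
have yimg : (linfun y @: Y)%VS = fullv.
  apply/eqP; rewrite eqEdim subvf /= dimvf /dim /= mul1n.
  have := limg_ker_dim (linfun y) Y; rewrite (spread_dim spreadD DY).
  have : (\dim (Y :&: lker (linfun y)) <= \dim A)%N.
    apply/dimvS/subvP => w; rewrite memv_cap memv_ker lfunE => /andP[wY /eqP].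
    exact: yY.
  rewrite dimA; dlia.
(* The rows of [M] are the [z]-coordinates of vectors of [Y] whose [y]-coordinates form the standard
   basis. *)
have /fin_all_exists2[g gY yg] (i : 'I_n) : exists2 w, w \in Y & y w = delta_mx 0 i.
  have /memv_imgP[w wY ->] : (delta_mx 0 i : R) \in (linfun y @: Y)%VS by rewrite yimg memvf.
  by exists w; rewrite ?lfunE.
pose M := \matrix_i z (g i).
pose h (c : R) := \sum_i c 0 i *: g i.
have hY c : h c \in Y by apply: rpred_sum => i _; rewrite rpredZ.
have yh c : y (h c) = c.
  by rewrite linear_sum [RHS]row_sum_delta; apply: eq_bigr => i _; rewrite linearZ /= yg.
have zh c : z (h c) = c *m M.
  by rewrite linear_sum mulmx_sum_row; apply: eq_bigr => i _; rewrite linearZ /= rowK.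
exists M.
  exists Y => // w [xw zw]; rewrite -[w](subrK (h (y w))) rpredD //.
  by apply/(subvP AY)/memA; rewrite !linearB yh zh xw zw xY // !subrr.
have /memA[_ _] : v - h a \in A.
  by apply: yY; rewrite ?rpredB // linearB yh yv subrr.
by rewrite linearB zh zv => /eqP; rewrite subr_eq0 => /eqP.
Qed.

(** By transitivity, the spread element through a vector outside [A] is given by equations whose
    coefficients are slopes, and such equations survive multiplication by a matrix that commutes
    with all slopes. *)
Lemma spread_stable C Y v v' : (forall M, slope M -> M *m C = C *m M) ->
  D Y -> v \in Y -> x v' = x v *m C -> y v' = y v *m C -> z v' = z v *m C -> v' \in Y.
Proof.
move=> commC DY vY xv' yv' zv'; have AY := spread_sub spreadD DY.
have [/memA[xv yv zv]|vA] := boolP (v \in A).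
  by apply/(subvP AY)/memA; rewrite xv' yv' zv' xv yv zv !mul0mx.
suff [p [Y' DY' pY'] [pv pv']] : exists2 p, elt_has p &
    p (x v) (y v) (z v) /\ p (x v') (y v') (z v').
  by rewrite (spread_eq spreadD DY DY' vA vY (pY' v pv)); apply: pY'.
have [yv0|yv0] := eqVneq (y v) 0; last first.
  have [M sM xM] := slope_transitive (x v) yv0.
  have [N sN zN] := slope_transitive (z v) yv0.
  exists (fun a b c => a = b *m M /\ c = b *m N).
    apply: (elt_meet (slope_pln_xy sM) (slope_pln_yz sN)) => [a b c|//].
    by exists (b *m M), b, (c); rewrite !subrr mul0mx.
  by rewrite xM zN xv' yv' zv' -!mulmxA -!commC // !mulmxA xM zN.
have [xv0|xv0] := eqVneq (x v) 0; last first.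
  have [N sN zN] := slope_transitive (z v) xv0.
  exists (fun a b c => b = 0 /\ c = a *m N); first exact: slope_xz.
  by rewrite xv' yv' zv' yv0 mul0mx -mulmxA -commC // mulmxA zN.
exists (fun a b c => a = 0 /\ b = 0); first exact: eltZ.
by rewrite xv' yv' xv0 yv0 !mul0mx.
Qed.

End SpreadCoordinates.

(** * Finite fields of matrices *)

Section MatrixField.
Variables (F : finFieldType) (n' : nat) (S : {set 'M[F]_n'.+1}).
Hypothesis S1 : 1 \in S.
Hypothesis SB : {in S &, forall M N, M - N \in S}.
Hypothesis SM : {in S &, forall M N, M * N \in S}.
Hypothesis Sunit : {in S, forall M, M != 0 -> M \is a GRing.unit}.

Let inS (M : 'M[F]_n'.+1) : bool := M \in S.

(** Multiplication by a nonzero [N] is injective on the finite set [S], hence onto, so 1 is [N * L]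
    with [L] in [S]. *)
Fact inS_divring : GRing.divring_closed inS.
Proof.
split=> [|M N|M N]; [exact: S1 | exact: SB | rewrite !unfold_in => MS NS].
apply: SM => //; have [->|N0] := eqVneq N 0; first by rewrite invr0 -(subrr 1) SB.
have Nunit := Sunit NS N0.
pose f M := N * M; have injf : injective f := mulrI Nunit.
have /eqP fS : f @: S == S.
  rewrite eqEcard card_imset // leqnn andbT; apply/subsetP => _ /imsetP[L LS ->].
  exact: SM.
by move: S1; rewrite -{1}fS => /imsetP[L LS fL]; rewrite -[N^-1]mulr1 fL mulKr.
Qed.
HB.instance Definition _ :=
  GRing.isDivringClosed.Build ('M[F]_n'.+1 : unitRingType) inS inS_divring.

Definition matrix_field := {M : 'M[F]_n'.+1 | inS M}.
HB.instance Definition _ := SubType.on matrix_field.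
HB.instance Definition _ := Finite.on matrix_field.
HB.instance Definition _ := [SubChoice_isSubUnitRing of matrix_field by <:].

Lemma matrix_field_dom : GRing.integral_domain_axiom matrix_field.
Proof.
move=> M N /(congr1 val); rewrite rmorphM /= => MN.
have [//|M0] := boolP (M == 0); rewrite /= -(inj_eq val_inj) /=.
have Mu : val M \is a GRing.unit by apply: Sunit (valP M) _; apply: contra M0 => /eqP M0; apply/eqP/val_inj.
by rewrite -(mulKr Mu (val N)) MN mulr0 eqxx.
Qed.

(** [FinDomainFieldType] is Wedderburn's theorem; it supplies commutativity. *)
Lemma matrix_fieldP : exists (K : finFieldType) (iota : K -> 'M[F]_n'.+1),
  [/\ injective iota, {morph iota : a b / a + b}, {morph iota : a b / a * b},
      iota 1 = 1 & forall M, M \in S <-> exists a, iota a = M].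
Proof.
exists (FinDomainFieldType matrix_field_dom), val.
split; first exact: val_inj.
- by move=> a b; apply: (rmorphD (val : matrix_field -> _)).
- by move=> a b; apply: (rmorphM (val : matrix_field -> _)).
- exact: (rmorph1 (val : matrix_field -> _)).
- by move=> M; split=> [MS|[a <-]]; [exists (Sub M MS) | exact: (valP a)].
Qed.

End MatrixField.

(** * The field of an egg with two good elements *)

Section GeneralPosition.
Variables (F : finFieldType) (n : nat).
Variable E : {set {vspace 'rV[F]_(2 * n + 2 * n)}}.
Hypotheses (n_gt0 : (0 < n)%N) (eggE : is_egg E) (q_gt3 : (3 < #|F| ^ n)%N).
Local Notation q := #|F|.
Implicit Types A B X Y Z U P : {vspace 'rV[F]_(2 * n + 2 * n)}.

Let m_gt0 : (0 < 2 * n)%N. Proof. by rewrite muln_gt0. Qed.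

Lemma rich_disjoint A X Y Z : good E A -> A \in E -> X \in E -> Y \in E -> Z \in E ->
  A != X -> A != Y -> X != Y -> ~~ (Z <= A + X + Y)%VS -> ((A + X + Y) :&: Z)%VS = 0%VS.
Proof.
move=> goodA AE XE YE ZE AX AY XY ZP.
have AP : (A <= A + X + Y)%VS by rewrite -addvA addvSl.
have ZA : Z != A by apply: contraNneq ZP => ->.
apply: vs_capP => v vP vZ; apply/eqP; apply: contraNT ZP => v0.
apply: (rich_sub n_gt0 m_gt0 eggE AE AP _ _ ZE ZA vP).
- by rewrite (egg_dim3 eggE).
- by apply: goodA; rewrite // eq_sym.
- by rewrite (subvP (addvSl _ _)).
- by apply: contra v0 => vA; rewrite -memv0 -(egg_cap n_gt0 m_gt0 eggE ZE AE ZA) memv_cap vZ.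
Qed.

Lemma sum3_eq A X Y P : A \in E -> X \in E -> Y \in E -> A != X -> A != Y -> X != Y ->
  \dim P = (3 * n)%N :> nat -> (A <= P)%VS -> (X <= P)%VS -> (Y <= P)%VS -> (A + X + Y)%VS = P.
Proof.
move=> AE XE YE AX AY XY dP AP XP YP; apply/eqP.
by rewrite eqEdim !subv_add AP XP YP dP (egg_dim3 eggE) // leqnn.
Qed.

(** Each of the four faces spanned by three of the [A_i] contains [A1] or [A2], so by
    [rich_disjoint] an element not inside it is skew from it. It remains to find a [B] inside none
    of them. *)
Lemma egg_general_position A1 A2 : A1 \in E -> A2 \in E -> A1 != A2 ->
  good E A1 -> good E A2 ->
  exists A3 A4 B, [/\ A3 \in E, A4 \in E & B \in E] /\
   [/\ uniq [:: A1; A2; A3; A4], (A4 + (A1 + A2 + A3))%VS = fullv,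
     (B :&: (A2 + A3 + A4) = 0)%VS /\ (B :&: (A1 + A3 + A4) = 0)%VS,
     (B :&: (A1 + A2 + A4) = 0)%VS & (B :&: (A1 + A2 + A3) = 0)%VS].
Proof.
move=> A1E A2E A12 good1 good2.
have [U tgU] : exists U, is_tangent E A1 U by case: eggE => _ _ _; apply.
have [A3 A3E /andP[A31 A32]] := egg_third m_gt0 eggE A1 A2.
have A13 : A1 != A3 by rewrite eq_sym.
have A23 : A2 != A3 by rewrite eq_sym.
pose P4 := (A1 + A2 + A3)%VS.
have dP4 : \dim P4 = (3 * n)%N :> nat by rewrite (egg_dim3 eggE).
have A1P4 : (A1 <= P4)%VS by rewrite /P4 -addvA addvSl.
have A3P4 : (A3 <= P4)%VS by rewrite addvSr.
(* If all elements were in [P4], so would be every vector outside [U] by [egg_cover], and then every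
   vector of [U] by [tangent_shift]. *)
have [A4 A4E A4P] : exists2 A4, A4 \in E & ~~ (A4 <= P4)%VS.
  apply/exists_inP; apply: contraT; rewrite negb_exists_in => /forall_inP HP.
  have {}HP X : X \in E -> (X <= P4)%VS by move=> /HP; rewrite negbK.
  have /subvPn[v _ vP] : ~~ (fullv <= P4)%VS.
    by apply/negP => /dimvS; rewrite dP4 dimvf /dim /= mul1n; dlia.
  case/negP: vP; have [vU|vU] := boolP (v \in U); last first.
    have [X XE /andP[_]] := egg_cover n_gt0 m_gt0 eggE A1E tgU vU.
    by apply/subvP; rewrite subv_add A1P4 HP.
  have [/(subvP A1P4)//|vA] := boolP (v \in A1).
  have [x [Z [xX _ vxZ [ZE _ _]]]] := tangent_shift n_gt0 eggE A1E tgU A3E A31 vU vA.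
  rewrite -[v](addrK x) rpredB // ?(subvP A3P4 x) //.
  by move: vxZ; apply/subvP; rewrite subv_add A1P4 HP.
have A14 : A1 != A4 by apply: contraNneq A4P => <-.
have A34 : A3 != A4 by apply: contraNneq A4P => <-.
have A24 : A2 != A4 by apply: contraNneq A4P => <-; rewrite /P4 (subv_trans (addvSr A1 A2)) ?addvSl.
have P4A4 : (P4 :&: A4)%VS = 0%VS by apply: rich_disjoint.
have full4 : (A4 + P4)%VS = fullv.
  apply/eqP; rewrite eqEdim subvf dimvf /dim /= mul1n.
  have := dimv_sum_cap A4 P4; rewrite (capvC A4) P4A4 dimv0 dP4 (egg_dim eggE A4E); dlia.
have cap0 A P : A \in E -> \dim P = (3 * n)%N :> nat -> (fullv <= A + P)%VS ->
    (P :&: A)%VS = 0%VS.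
  move=> AE dP /dimvS; rewrite dimvf /dim /= mul1n => full.
  apply/eqP; rewrite -dimv_eq0 capvC; have := dimv_sum_cap A P.
  rewrite dP (egg_dim eggE AE); move: full; dlia.
pose P3 := (A1 + A2 + A4)%VS; pose P2 := (A1 + A3 + A4)%VS; pose P1 := (A2 + A3 + A4)%VS.
have dP3 : \dim P3 = (3 * n)%N :> nat by rewrite (egg_dim3 eggE).
have dP2 : \dim P2 = (3 * n)%N :> nat by rewrite (egg_dim3 eggE).
have dP1 : \dim P1 = (3 * n)%N :> nat by rewrite (egg_dim3 eggE).
have A1P3 : (A1 <= P3)%VS by rewrite /P3 -addvA addvSl.
have A2P3 : (A2 <= P3)%VS by rewrite /P3 (subv_trans (addvSr A1 A2)) ?addvSl.
have A2P4 : (A2 <= P4)%VS by rewrite /P4 (subv_trans (addvSr A1 A2)) ?addvSl.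
have A1P2 : (A1 <= P2)%VS by rewrite /P2 -addvA addvSl.
have A2P1 : (A2 <= P1)%VS by rewrite /P1 -addvA addvSl.
have P3A3 : (P3 :&: A3)%VS = 0%VS.
  by apply: cap0; rewrite // -full4 !subv_add addvSl !(subv_trans _ (addvSr A3 P3)) ?addvSr.
have P2A2 : (P2 :&: A2)%VS = 0%VS.
  apply: cap0; rewrite // -full4 !subv_add addvSl !(subv_trans _ (addvSr A2 P2)) ?addvSr //.
  by rewrite (subv_trans (addvSr A1 A3)) ?addvSl.
have P1A1 : (P1 :&: A1)%VS = 0%VS.
  apply: cap0; rewrite // -full4 !subv_add addvSl !(subv_trans _ (addvSr A1 P1)) ?addvSr //.
  by rewrite (subv_trans (addvSr A2 A3)) ?addvSl.
have [u3 u3A u3n0] := egg_neq0 n_gt0 eggE A3E.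
have A41 : A4 != A1 by rewrite eq_sym.
(* The vector [u3 + u4] has nonzero components along [A3] and [A4], so it avoids the faces [P3] and
   [P4]; avoiding [U] as well, it is covered by some [X + A1]. *)
have [u4 u4A /andP[u4n0 uU]] := tangent_avoid n_gt0 eggE A1E tgU A4E A41 (ltnW q_gt3) u3.
have u4P4 : u4 \notin P4.
  by apply: contra u4n0 => u4P; rewrite -memv0 -P4A4 memv_cap u4P.
have u3P3 : u3 \notin P3.
  by apply: contra u3n0 => u3P; rewrite -memv0 -P3A3 memv_cap u3P.
have uP4 : u3 + u4 \notin P4.
  apply: contra u4P4 => uP; rewrite -[u4](addKr u3) addrC rpredB //.
  by rewrite (subvP A3P4).
have uP3 : u3 + u4 \notin P3.
  apply: contra u3P3 => uP; rewrite -[u3](addrK u4) rpredB //.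
  by rewrite (subvP (addvSr _ _)).
have [X XE /andP[XA1 uX]] := egg_cover n_gt0 m_gt0 eggE A1E tgU uU.
have A1X : A1 != X by rewrite eq_sym.
have A2X : A2 != X.
  apply: contraNneq uP4 => A2X; move: uX; apply/subvP.
  by rewrite -A2X /P4 addvC addvSl.
(* [B] is sought in [Q]. This plane shares [A1] and [A2] with [P3] and [P4] but differs from both,
   so no third element of [Q] lies in them. *)
pose Q := (A1 + A2 + X)%VS.
have dQ : \dim Q = (3 * n)%N :> nat by rewrite (egg_dim3 eggE).
have A1Q : (A1 <= Q)%VS by rewrite /Q -addvA addvSl.
have A2Q : (A2 <= Q)%VS by rewrite /Q (subv_trans (addvSr A1 A2)) ?addvSl.
have uQ : u3 + u4 \in Q.
  by move: uX; apply/subvP; rewrite subv_add A1Q addvSr.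
have richQ : rich E Q by apply: good1; rewrite // eq_sym.
pose T := [set B in E | (B <= Q)%VS].
(* Besides [A1], the face [P2] contains at most one element of [Q]: two would give [P2 = Q], while
   [A2] is in [Q] and skew from [P2]. Likewise for [P1] and [A2]. *)
pose R1 := [set B in T | (B != A1) && (B <= P2)%VS].
pose R2 := [set B in T | (B != A2) && (B <= P1)%VS].
have R1_le1 : (#|R1| <= 1)%N.
  apply/card_le1_eqP => B B' /[!inE] /andP[/andP[BE BQ] /andP[BA BP]].
  move=> /andP[/andP[B'E B'Q] /andP[B'A B'P]]; apply/eqP; apply: contraT => BB'.
  have eqS : P2 = Q.
    have AB : A1 != B by rewrite eq_sym.
    have AB' : A1 != B' by rewrite eq_sym.
    rewrite -(sum3_eq A1E B'E BE AB' AB BB' dP2) //.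
    exact: sum3_eq.
  have [v vA v0] := egg_neq0 n_gt0 eggE A2E.
  by case/negP: v0; rewrite -memv0 -P2A2 memv_cap vA eqS (subvP A2Q).
have R2_le1 : (#|R2| <= 1)%N.
  apply/card_le1_eqP => B B' /[!inE] /andP[/andP[BE BQ] /andP[BA BP]].
  move=> /andP[/andP[B'E B'Q] /andP[B'A B'P]]; apply/eqP; apply: contraT => BB'.
  have eqS : P1 = Q.
    have AB : A2 != B by rewrite eq_sym.
    have AB' : A2 != B' by rewrite eq_sym.
    rewrite -(sum3_eq A2E B'E BE AB' AB BB' dP1) //.
    exact: sum3_eq.
  have [v vA v0] := egg_neq0 n_gt0 eggE A1E.
  by case/negP: v0; rewrite -memv0 -P1A1 memv_cap vA eqS (subvP A1Q).
(* At most 2 + 1 + 1 = 4 elements of [Q] are excluded, out of at least q^n + 1 > 4. *)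
have /card_gt0P[B] : (0 < #|T :\: ([set A1; A2] :|: (R1 :|: R2))|)%N.
  rewrite cardsD subn_gt0; apply: leq_ltn_trans (_ : 4 < #|T|)%N; last first.
    exact: leq_ltn_trans q_gt3 richQ.
  rewrite (leq_trans (subset_leq_card (subsetIr _ _))) //.
  rewrite (leq_trans (leq_card_setU _ _)) // (@leq_add _ _ 2 2) //.
    by rewrite cards2; case: eqP.
  by rewrite (leq_trans (leq_card_setU _ _)) // (@leq_add _ _ 1 1).
rewrite !in_setD !in_setU !in_set1 !negb_or -!andbA => /and5P[BA1 BA2 BR1 BR2 BT].
have /andP[BE BQ] : (B \in E) && (B <= Q)%VS by move: BT; rewrite inE.
have A1B : A1 != B by rewrite eq_sym.
have A2B : A2 != B by rewrite eq_sym.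
have BP2 : ~~ (B <= P2)%VS by move: BR1; rewrite inE BT BA1.
have BP1 : ~~ (B <= P1)%VS by move: BR2; rewrite inE BT BA2.
have BP4 : ~~ (B <= P4)%VS.
  apply: contra uP4 => BP; rewrite -(@sum3_eq A1 A2 B P4) //.
  by rewrite (@sum3_eq A1 A2 B Q).
have BP3 : ~~ (B <= P3)%VS.
  apply: contra uP3 => BP; rewrite -(@sum3_eq A1 A2 B P3) //.
  by rewrite (@sum3_eq A1 A2 B Q).
exists A3, A4, B; split=> //; split.
- by rewrite /= !inE !negb_or A12 A13 A14 A23 A24 A34.
- by [].
- by split; rewrite capvC; apply: rich_disjoint.
- by rewrite capvC; apply: rich_disjoint.
- by rewrite capvC; apply: rich_disjoint.
Qed.

End GeneralPosition.

(** * Coordinates adapted to a frame of egg elements *)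

Section Coordinates.
Variables (F : finFieldType) (n k : nat).
Local Notation R := 'rV[F]_n.
Implicit Types B X P : {vspace 'rV[F]_k}.

Lemma hom_onto (c : 'Hom('rV[F]_k, R)) X : \dim X = n :> nat ->
  (forall v, v \in X -> c v = 0 -> v = 0) -> forall a, exists2 v, v \in X & c v = a.
Proof.
move=> dX injc a; suff : a \in (c @: X)%VS by case/memv_imgP => v vX ->; exists v.
suff -> : (c @: X)%VS = fullv by rewrite memvf.
apply/eqP; rewrite eqEdim subvf /= dimvf /dim /= mul1n.
have := limg_ker_dim c X; rewrite dX vs_capP ?dimv0; first by dlia.
by move=> v vX; rewrite memv_ker => /eqP; apply: injc.
Qed.

(** [c] is the projection onto [B] along [P], read in a basis of [B]. As [e] is fixed before [P],
    projections along different complements agree on [B], which makes [B] the diagonal. *)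
Lemma coordinates_along B : \dim B = n :> nat -> exists e : 'rV[F]_k -> R,
  forall P, (B :&: P)%VS = 0%VS -> (B + P)%VS = fullv -> exists c : 'Hom('rV[F]_k, R),
    (forall v, c v = 0 <-> v \in P) /\ (forall v, v \in B -> c v = e v).
Proof.
move=> dB; pose g (v : 'rV[F]_k) : R := \row_(j < n) coord (vbasis B) (cast_ord (esym dB) j) v.
have lin_g : linear g by move=> a u v; apply/rowP => j; rewrite !mxE linearP.
pose G : {linear 'rV[F]_k -> R} := HB.pack g (GRing.isLinear.Build _ _ _ _ g lin_g).
exists g => P BP0 BPfull; exists (linfun G \o daddv_pi B P)%VF.
have cE v : (linfun G \o daddv_pi B P)%VF v = g (daddv_pi B P v).
  by rewrite comp_lfunE lfunE.
split=> [v|v vB]; last by rewrite cE daddv_pi_id.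
rewrite cE; have vE : daddv_pi B P v + daddv_pi P B v = v.
  by rewrite daddv_pi_add // BPfull memvf.
have bB := memv_pi B P v; have pP := memv_pi P B v.
split=> [g0|vP].
  rewrite -vE (coord_vbasis bB) big1 ?add0r // => i _.
  have := congr1 (fun r : R => r 0 (cast_ord dB i)) g0.
  by rewrite !mxE cast_ordK => ->; rewrite scale0r.
suff -> : daddv_pi B P v = 0 by apply/rowP => j; rewrite !mxE linear0.
apply/eqP; rewrite -memv0 -BP0 memv_cap bB /= -[daddv_pi B P v](addrK (daddv_pi P B v)).
by rewrite vE rpredB.
Qed.

End Coordinates.

(* The c_i are the projections onto B along the sums of three of the A_j: the A_i
   are the coordinate axes and B is the diagonal. *)
Record quad_frame (F : finFieldType) (n k : nat) (A1 A2 A3 A4 B : {vspace 'rV[F]_k})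
    (c1 c2 c3 c4 : 'Hom('rV[F]_k, 'rV[F]_n)) : Prop := QuadFrame {
  quad_onto : forall a1 a2 a3 a4, exists v,
    [/\ c1 v = a1, c2 v = a2, c3 v = a3 & c4 v = a4];
  quad_inj : forall v, c1 v = 0 -> c2 v = 0 -> c3 v = 0 -> c4 v = 0 -> v = 0;
  quad_mem1 : forall v, v \in A1 <-> [/\ c2 v = 0, c3 v = 0 & c4 v = 0];
  quad_mem2 : forall v, v \in A2 <-> [/\ c1 v = 0, c3 v = 0 & c4 v = 0];
  quad_mem3 : forall v, v \in A3 <-> [/\ c1 v = 0, c2 v = 0 & c4 v = 0];
  quad_mem4 : forall v, v \in A4 <-> [/\ c1 v = 0, c2 v = 0 & c3 v = 0];
  quad_diag : forall v, c1 v = c2 v -> c3 v = c2 v -> c4 v = c2 v -> v \in B }.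

(** With it the spreads modulo [A1] and modulo [A2] are read in the same coordinates. *)
Lemma quad_frame_swap (F : finFieldType) (n k : nat) (A1 A2 A3 A4 B : {vspace 'rV[F]_k})
    (c1 c2 c3 c4 : 'Hom('rV[F]_k, 'rV[F]_n)) :
  quad_frame A1 A2 A3 A4 B c1 c2 c3 c4 -> quad_frame A2 A1 A3 A4 B c2 c1 c3 c4.
Proof.
case=> onto inj m1 m2 m3 m4 diag; split=> //.
- by move=> a1 a2 a3 a4; have [v []] := onto a2 a1 a3 a4; exists v.
- by move=> v *; apply: inj.
- by move=> v; rewrite m3; split=> -[].
- by move=> v; rewrite m4; split=> -[].
- by move=> v e1 e3 e4; apply: diag; rewrite // ?e3 ?e4 e1.
Qed.

Section QuadFrame.
Variables (F : finFieldType) (n k : nat).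
Variables A1 A2 A3 A4 B : {vspace 'rV[F]_k}.
Implicit Types X Y Z P : {vspace 'rV[F]_k}.
Hypotheses (kE : k = (4 * n)%N) (full4 : (A4 + (A1 + A2 + A3))%VS = fullv).
Hypotheses (d1 : \dim A1 = n :> nat) (d2 : \dim A2 = n :> nat)
  (d3 : \dim A3 = n :> nat) (d4 : \dim A4 = n :> nat) (dB : \dim B = n :> nat).

Lemma quad_decomp v : exists v1 v2 v3 v4,
  [/\ v1 \in A1, v2 \in A2, v3 \in A3 & v4 \in A4] /\ v = v1 + v2 + v3 + v4.
Proof.
have : v \in (A4 + (A1 + A2 + A3))%VS by rewrite full4 memvf.
case/memv_addP => v4 v4A [_ /memv_addP[_ /memv_addP[v1 v1A [v2 v2A ->]] [v3 v3A ->]] ->].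
by exists v1, v2, v3, v4; rewrite addrC.
Qed.

Lemma quad_cap X P : \dim X = n :> nat -> (\dim P <= 3 * n)%N -> (X + P)%VS = fullv ->
  (X :&: P)%VS = 0%VS.
Proof.
move=> dX dP XP; apply/eqP; rewrite -dimv_eq0; have := dimv_sum_cap X P.
have dV : \dim (fullv : {vspace 'rV[F]_k}) = (4 * n)%N :> nat.
  by rewrite dimvf /dim /= mul1n.
by rewrite XP dX dV; move: dP; dlia.
Qed.

Lemma quad_sum X P : \dim X = n :> nat -> (3 * n <= \dim P)%N -> (X :&: P)%VS = 0%VS ->
  (X + P)%VS = fullv.
Proof.
move=> dX dP XP; apply/eqP; rewrite eqEdim subvf; have := dimv_sum_cap X P.
have dV : \dim (fullv : {vspace 'rV[F]_k}) = (4 * n)%N :> nat.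
  by rewrite dimvf /dim /= mul1n.
by rewrite XP dX dV dimv0; move: dP; dlia.
Qed.

Lemma dim_sum3 X Y Z : \dim X = n :> nat -> \dim Y = n :> nat -> \dim Z = n :> nat ->
  (\dim (X + Y + Z) <= 3 * n)%N.
Proof.
move=> dX dY dZ; have := dimv_sum_cap (X + Y) Z; have := dimv_sum_cap X Y.
rewrite dX dY dZ; dlia.
Qed.

Lemma quad_frame_exists :
  (B :&: (A2 + A3 + A4) = 0)%VS -> (B :&: (A1 + A3 + A4) = 0)%VS ->
  (B :&: (A1 + A2 + A4) = 0)%VS -> (B :&: (A1 + A2 + A3) = 0)%VS ->
  exists c1 c2 c3 c4 : 'Hom('rV[F]_k, 'rV[F]_n), quad_frame A1 A2 A3 A4 B c1 c2 c3 c4.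
Proof.
move=> B1 B2 B3 B4.
have full X P : (A1 <= X + P -> A2 <= X + P -> A3 <= X + P -> A4 <= X + P ->
    X + P = fullv)%VS.
  by move=> H1 H2 H3 H4; apply/eqP; rewrite eqEsubv subvf -full4 !subv_add H1 H2 H3 H4.
have in1 X Y Z : (X <= X + Y + Z)%VS by rewrite -addvA addvSl.
have in2 X Y Z : (Y <= X + Y + Z)%VS by rewrite (subv_trans (addvSr X Y)) ?addvSl.
have in3 X Y Z : (Z <= X + Y + Z)%VS by rewrite addvSr.
have inS X Y P : (Y <= P -> Y <= X + P)%VS by move=> YP; rewrite (subv_trans YP) ?addvSr.
have s1 : (A1 + (A2 + A3 + A4))%VS = fullv by apply: full; try exact: addvSl; apply: inS; (exact: in1 || exact: in2 || exact: in3).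
have s2 : (A2 + (A1 + A3 + A4))%VS = fullv by apply: full; try exact: addvSl; apply: inS; (exact: in1 || exact: in2 || exact: in3).
have s3 : (A3 + (A1 + A2 + A4))%VS = fullv by apply: full; try exact: addvSl; apply: inS; (exact: in1 || exact: in2 || exact: in3).
have i1 := quad_cap d1 (dim_sum3 d2 d3 d4) s1.
have i2 := quad_cap d2 (dim_sum3 d1 d3 d4) s2.
have i3 := quad_cap d3 (dim_sum3 d1 d2 d4) s3.
have i4 := quad_cap d4 (dim_sum3 d1 d2 d3) full4.
have dimP X P : \dim X = n :> nat -> (X + P)%VS = fullv -> (3 * n <= \dim P)%N.
  move=> dX XP; have := dimv_sum_cap X P.
  have dV : \dim (fullv : {vspace 'rV[F]_k}) = (4 * n)%N :> nat.
    by rewrite dimvf /dim /= mul1n.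
  by rewrite XP dX dV; dlia.
have [e He] := coordinates_along dB.
have [c1 [k1 e1]] := He _ B1 (quad_sum dB (dimP _ _ d1 s1) B1).
have [c2 [k2 e2]] := He _ B2 (quad_sum dB (dimP _ _ d2 s2) B2).
have [c3 [k3 e3]] := He _ B3 (quad_sum dB (dimP _ _ d3 s3) B3).
have [c4 [k4 e4]] := He _ B4 (quad_sum dB (dimP _ _ d4 full4) B4).
have z1 v : v \in A1 -> [/\ c2 v = 0, c3 v = 0 & c4 v = 0].
  by move=> vA; split; [apply/k2 | apply/k3 | apply/k4]; apply: (subvP _ _ vA).
have z2 v : v \in A2 -> [/\ c1 v = 0, c3 v = 0 & c4 v = 0].
  by move=> vA; split; [apply/k1 | apply/k3 | apply/k4]; apply: (subvP _ _ vA).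
have z3 v : v \in A3 -> [/\ c1 v = 0, c2 v = 0 & c4 v = 0].
  by move=> vA; split; [apply/k1 | apply/k2 | apply/k4]; apply: (subvP _ _ vA).
have z4 v : v \in A4 -> [/\ c1 v = 0, c2 v = 0 & c3 v = 0].
  by move=> vA; split; [apply/k1 | apply/k2 | apply/k3]; apply: (subvP _ _ vA).
have cap_eq X P v : (X :&: P)%VS = 0%VS -> v \in X -> v \in P -> v = 0.
  by move=> XP vX vP; apply/eqP; rewrite -memv0 -XP memv_cap vX.
have j1 v : v \in A1 -> c1 v = 0 -> v = 0 by move=> vA /k1; apply: cap_eq i1 vA.
have j2 v : v \in A2 -> c2 v = 0 -> v = 0 by move=> vA /k2; apply: cap_eq i2 vA.
have j3 v : v \in A3 -> c3 v = 0 -> v = 0 by move=> vA /k3; apply: cap_eq i3 vA.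
have j4 v : v \in A4 -> c4 v = 0 -> v = 0 by move=> vA /k4; apply: cap_eq i4 vA.
have coordE v1 v2 v3 v4 : v1 \in A1 -> v2 \in A2 -> v3 \in A3 -> v4 \in A4 ->
    let v := v1 + v2 + v3 + v4 in
    [/\ c1 v = c1 v1, c2 v = c2 v2, c3 v = c3 v3 & c4 v = c4 v4].
  move=> /z1[x2 x3 x4] /z2[y1 y3 y4] /z3[t1 t2 t4] /z4[w1 w2 w3] /=.
  by rewrite !linearD /= x2 x3 x4 y1 y3 y4 t1 t2 t4 w1 w2 w3 !add0r !addr0.
have dec v : exists v1 v2 v3 v4, [/\ v1 \in A1, v2 \in A2, v3 \in A3 & v4 \in A4] /\
   (v = v1 + v2 + v3 + v4 /\ [/\ c1 v = c1 v1, c2 v = c2 v2, c3 v = c3 v3 & c4 v = c4 v4]).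
  have [v1 [v2 [v3 [v4 [[m1 m2 m3 m4] ->]]]]] := quad_decomp v.
  by exists v1, v2, v3, v4; split=> //; split=> //; apply: coordE.
have inj v : c1 v = 0 -> c2 v = 0 -> c3 v = 0 -> c4 v = 0 -> v = 0.
  have [v1 [v2 [v3 [v4 [[m1 m2 m3 m4] [-> [-> -> -> ->]]]]]]] := dec v.
  by move=> /j1-> // /j2-> // /j3-> // /j4-> //; rewrite !addr0.
exists c1, c2, c3, c4; split=> //.
- move=> a1 a2 a3 a4.
  have [v1 m1 <-] := hom_onto d1 j1 a1; have [v2 m2 <-] := hom_onto d2 j2 a2.
  have [v3 m3 <-] := hom_onto d3 j3 a3; have [v4 m4 <-] := hom_onto d4 j4 a4.
  by exists (v1 + v2 + v3 + v4); apply: coordE.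
- move=> v; split=> [/z1//|].
  have [v1 [v2 [v3 [v4 [[m1 m2 m3 m4] [vE [w1 w2 w3 w4]]]]]]] := dec v; rewrite ?w1 ?w2 ?w3 ?w4.
  by case=> /j2 h2 /j3 h3 /j4 h4; rewrite vE h2 // h3 // h4 // !addr0.
- move=> v; split=> [/z2//|].
  have [v1 [v2 [v3 [v4 [[m1 m2 m3 m4] [vE [w1 w2 w3 w4]]]]]]] := dec v; rewrite ?w1 ?w2 ?w3 ?w4.
  by case=> /j1 h1 /j3 h3 /j4 h4; rewrite vE h1 // h3 // h4 // !addr0 add0r.
- move=> v; split=> [/z3//|].
  have [v1 [v2 [v3 [v4 [[m1 m2 m3 m4] [vE [w1 w2 w3 w4]]]]]]] := dec v; rewrite ?w1 ?w2 ?w3 ?w4.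
  by case=> /j1 h1 /j2 h2 /j4 h4; rewrite vE h1 // h2 // h4 // !addr0 !add0r.
- move=> v; split=> [/z4//|].
  have [v1 [v2 [v3 [v4 [[m1 m2 m3 m4] [vE [w1 w2 w3 w4]]]]]]] := dec v; rewrite ?w1 ?w2 ?w3 ?w4.
  by case=> /j1 h1 /j2 h2 /j3 h3; rewrite vE h1 // h2 // h3 // !add0r.
(* The [u] in [B] with [c2 u = c2 v] has four equal coordinates, since the [c_i] agree on [B]; so
   has [v], hence [v = u]. *)
move=> v E1 E3 E4.
have jB u : u \in B -> c2 u = 0 -> u = 0 by move=> uB /k2; apply: cap_eq B2 uB.
have [u uB uE] := hom_onto dB jB (c2 v).
suff -> : v = u by [].
apply/eqP; rewrite -subr_eq0; apply/eqP/inj; rewrite linearB /=.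
- by rewrite (e1 u uB) -(e2 u uB) uE E1 subrr.
- by rewrite uE subrr.
- by rewrite (e3 u uB) -(e2 u uB) uE E3 subrr.
- by rewrite (e4 u uB) -(e2 u uB) uE E4 subrr.
Qed.

End QuadFrame.

(** * Slopes read off the egg *)

Section EggSlopes.
Variables (F : finFieldType) (n' : nat).
Local Notation n := n'.+1.
Local Notation q := #|F|.
Local Notation V := 'rV[F]_(2 * n + 2 * n).
Local Notation R := 'rV[F]_n.
Variable E : {set {vspace V}}.
Hypothesis eggE : is_egg E.

Let n_gt0 : (0 < n)%N. Proof. by []. Qed.
Let m_gt0 : (0 < 2 * n)%N. Proof. by []. Qed.

Section OneCenter.
Variables (A1 A2 A3 A4 B U : {vspace V}) (c1 c2 c3 c4 : 'Hom(V, R)).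
Hypothesis fr : quad_frame A1 A2 A3 A4 B c1 c2 c3 c4.
Hypotheses (A1E : A1 \in E) (A2E : A2 \in E) (A3E : A3 \in E) (A4E : A4 \in E)
  (BE : B \in E).
Hypotheses (A21 : A2 != A1) (A31 : A3 != A1) (A41 : A4 != A1) (B1 : B != A1).
Hypotheses (good1 : good E A1) (tgU : is_tangent E A1 U).

Lemma mem_frame12 v : v \in (A2 + A1)%VS <-> c3 v = 0 /\ c4 v = 0.
Proof.
case: fr => onto inj m1 m2 m3 m4 diag; split=> [/memv_addP[v2 /m2[_ a b] [v1 /m1[_ c d] ->]]|[v3 v4]].
  by rewrite !linearD /= a b c d !addr0.
have [w [w1 w2 w3 w4]] := onto 0 (c2 v) 0 0.
by rewrite -[v](subrK w) addrC memv_add //; [apply/m2 | apply/m1; rewrite !linearB /= w2 w3 w4 v3 v4 !subrr].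
Qed.

Lemma mem_frame13 v : v \in (A3 + A1)%VS <-> c2 v = 0 /\ c4 v = 0.
Proof.
case: fr => onto inj m1 m2 m3 m4 diag; split=> [/memv_addP[v2 /m3[_ a b] [v1 /m1[c _ d] ->]]|[v3 v4]].
  by rewrite !linearD /= a b c d !addr0.
have [w [w1 w2 w3 w4]] := onto 0 0 (c3 v) 0.
by rewrite -[v](subrK w) addrC memv_add //; [apply/m3 | apply/m1; rewrite !linearB /= w2 w3 w4 v3 v4 !subrr].
Qed.

Lemma mem_frame14 v : v \in (A4 + A1)%VS <-> c2 v = 0 /\ c3 v = 0.
Proof.
case: fr => onto inj m1 m2 m3 m4 diag; split=> [/memv_addP[v2 /m4[_ a b] [v1 /m1[c d _] ->]]|[v3 v4]].
  by rewrite !linearD /= a b c d !addr0.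
have [w [w1 w2 w3 w4]] := onto 0 0 0 (c4 v).
by rewrite -[v](subrK w) addrC memv_add //; [apply/m4 | apply/m1; rewrite !linearB /= w2 w3 w4 v3 v4 !subrr].
Qed.

Lemma egg_spread_frame :
  spread_frame A1 (spread_elt E A1 U) (spread_pln E A1 U) c2 c3 c4.
Proof.
have [onto inj m1 m2 m3 m4 diag] := fr.
have eltP X : X \in E -> X != A1 -> spread_elt E A1 U (X + A1)%VS.
  by move=> XE XA; left; exists X.
split.
- by rewrite -mulnDl.
- exact: (egg_dim eggE A1E).
- exact: good_spread.
- exact: m1.
- by move=> a b c; have [v [_ ? ? ?]] := onto 0 a b c; exists v.
- by exists (A2 + A1)%VS; [apply: eltP | apply: mem_frame12].
- by exists (A3 + A1)%VS; [apply: eltP | apply: mem_frame13].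
- by exists (A4 + A1)%VS; [apply: eltP | apply: mem_frame14].
exists (B + A1)%VS; first exact: eltP.
move=> v e1 e2; have [w [w1 w2 w3 w4]] := onto (c3 v) (c3 v) (c3 v) (c3 v).
rewrite -[v](subrK w) addrC memv_add //; first by apply: diag; rewrite ?w1 ?w2 ?w3 ?w4.
by apply/m1; rewrite !linearB /= w2 w3 w4 e1 e2 !subrr.
Qed.

Local Notation slope1 := (slope (spread_elt E A1 U) c2 c3 c4).

(** The plane [c4 = c3 M] contains [A2], so it is not [U]; it is some [A1 + X + Y], and [X] or [Y]
    differs from [A2]. The conclusion is symmetric in [A1] and [A2], which is what links the slopes
    of the two spreads. *)
Lemma slope_egg M : slope1 M -> exists2 X, X \in E &
  [/\ X != A1, X != A2 & forall v, v \in X -> c4 v = c3 v *m M].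
Proof.
move=> sM; have frD := egg_spread_frame; have [onto inj m1 m2 m3 m4 diag] := fr.
have [Q PQ HQ'] := slope_pln_yz frD sM.
have HQ v : c4 v = c3 v *m M -> v \in Q by apply: HQ'.
have A2Q : (A2 <= Q)%VS.
  by apply/subvP => v /m2[_ v3 v4]; apply: HQ; rewrite v3 v4 mul0mx.
(* [Q] is exactly the subspace [c4 = c3 M]: a further vector would bring a vector of [A4] outside
   [A1], then all of [A4 + A1], into [Q], which would be everything. *)
have QM w : w \in Q -> c4 w = c3 w *m M.
  move=> wQ; apply/eqP; apply: contraT => wM.
  have [w1 [x1 x2 x3 x4]] := onto (c1 w) (c2 w) (c3 w) (c3 w *m M).
  have w1Q : w1 \in Q by apply: HQ; rewrite x3 x4.
  have wA4 : w - w1 \in A4 by apply/m4; rewrite !linearB /= x1 x2 x3 !subrr.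
  have wA1 : w - w1 \notin A1.
    by apply: contra wM => /m1[_ _]; rewrite linearB /= x4 => /eqP; rewrite subr_eq0.
  have A4Q : (A4 + A1 <= Q)%VS.
    apply: (spread_plane (frame_spread frD) _ PQ wA1); first by left; exists A4.
      by rewrite (subvP (addvSl _ _)).
    by rewrite rpredB.
  have [t /negP[]] := pln_proper frD PQ.
  have [t1 [y1 y2 y3 y4]] := onto (c1 t) (c2 t) (c3 t) (c3 t *m M).
  rewrite -[t](subrK t1) rpredD //; last by apply: HQ; rewrite y3 y4.
  by apply/(subvP A4Q)/mem_frame14; rewrite !linearB /= y2 y3 !subrr.
case: PQ => [QU|[X [Y [[XE YE XA YA XY] QE]]]].
  have [v vA v0] := egg_neq0 n_gt0 eggE A2E.
  by case/negP: v0; rewrite -memv0 -(tangent_cap tgU A2E A21) -QU memv_cap vA (subvP A2Q).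
have [XA2|XA2] := eqVneq X A2; last first.
  exists X => //; split=> // v vX; apply: QM.
  by rewrite QE (subvP (addvSl _ _)) // (subvP (addvSr _ _)).
exists Y => //; split=> //; first by rewrite -XA2 eq_sym.
by move=> v vY; apply: QM; rewrite QE (subvP (addvSr _ _)).
Qed.

(** The plane [c4 = c3 M] is the join of [X + A1] and [A2 + A1], because [c3] maps [X] onto F^n: a
    vector of [X] killed by [c3] is also killed by [c4], so it lies in [A2 + A1], which is skew from
    [X]. *)
Lemma egg_slope M X : X \in E -> X != A1 -> X != A2 ->
  (forall v, v \in X -> c4 v = c3 v *m M) -> slope1 M.
Proof.
move=> XE XA1 XA2 HX; have frD := egg_spread_frame; have [onto inj m1 m2 m3 m4 diag] := fr.
have injX v : v \in X -> c3 v = 0 -> v = 0.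
  move=> vX v3; have v4 : c4 v = 0 by rewrite HX // v3 mul0mx.
  apply/eqP; rewrite -memv0 -(egg_cap3 n_gt0 m_gt0 eggE A2E A1E XE) // 1?eq_sym //.
  by rewrite memv_cap vX andbT; apply/mem_frame12.
apply: (slope_of_pln frD).
have eX : elt_has (spread_elt E A1 U) c2 c3 c4
    (fun a b c => exists2 t, t \in X & [/\ c2 t = a, c3 t = b & c4 t = c]).
  exists (X + A1)%VS; first by left; exists X.
  move=> v [t tX [t2 t3 t4]]; rewrite -[v](subrK t) addrC memv_add //.
  by apply/m1; rewrite !linearB /= t2 t3 t4 !subrr.
apply: (pln_join frD eX (eltX frD)) => a b c ->.
have [t tX tb] := hom_onto (egg_dim eggE XE) injX b.
exists (c2 t), b, (b *m M); split; first by exists t; rewrite // HX // tb.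
by rewrite !subrr.
Qed.

End OneCenter.
End EggSlopes.

(** [K] is the field of slopes modulo [A1], acting on each of the four coordinates by right
    multiplication. Evaluation at a nonzero vector identifies [K] with F^n, and [phi] inverts it
    coordinatewise. *)
Lemma egg_field (F : finFieldType) (n' : nat)
    (E : {set {vspace 'rV[F]_(2 * n'.+1 + 2 * n'.+1)}}) A1 A2 :
  is_egg E -> (3 < #|F| ^ n'.+1)%N -> A1 \in E -> A2 \in E -> A1 != A2 ->
  good E A1 -> good E A2 ->
  exists (K : finFieldType)
    (phi : 'rV[F]_(2 * n'.+1 + 2 * n'.+1) -> 'rV[K]_(2 * 1 + 2)),
    [/\ #|K| = (#|F| ^ n'.+1)%N, bijective phi, {morph phi : u v / u + v} &
      forall A a v v', A \in E -> v \in A -> phi v' = a *: phi v -> v' \in A].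
Proof.
have dimE4 : (n'.+1 * (1 * (2 * 1 + 2)) = 1 * (2 * n'.+1 + 2 * n'.+1))%N by lia.
move=> eggE q_gt3 A1E A2E A12 good1 good2.
have n_gt0 : (0 < n'.+1)%N by [].
have m_gt0 : (0 < 2 * n'.+1)%N by [].
have [A3 [A4 [B [[A3E A4E BE] [uniqA full4 [cap1 cap2] cap3 cap4]]]]] :=
  egg_general_position n_gt0 eggE q_gt3 A1E A2E A12 good1 good2.
have [A13 A14 A23 A24] : [/\ A3 != A1, A4 != A1, A3 != A2 & A4 != A2].
  move: uniqA; rewrite /= !inE !negb_or -!andbA => /and5P[_ ? ? ?] /andP[? _].
  by split; rewrite eq_sym.
have A21 : A2 != A1 by rewrite eq_sym.
have dimE X : X \in E -> \dim X = n'.+1 :> nat by move=> XE; exact: (egg_dim eggE XE).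
have kE : (2 * n'.+1 + 2 * n'.+1 = 4 * n'.+1)%N by rewrite -mulnDl.
have [c1 [c2 [c3 [c4 fr]]]] := quad_frame_exists kE full4 (dimE _ A1E) (dimE _ A2E)
  (dimE _ A3E) (dimE _ A4E) (dimE _ BE) cap1 cap2 cap3 cap4.
have fr' := quad_frame_swap fr; have [onto inj m1 m2 m3 m4 _] := fr.
have B_neq A X Y : A \in E -> (B :&: (A + X + Y))%VS = 0%VS -> B != A.
  move=> AE BA; have [v vB v0] := egg_neq0 n_gt0 eggE BE; apply: contraNneq v0 => BAE.
  by rewrite -memv0 -BA memv_cap vB -addvA (subvP (addvSl A _)) -?BAE.
have B1 : B != A1 := B_neq A1 A2 A3 A1E cap4.
have B2 : B != A2 := B_neq A2 A3 A4 A2E cap1.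
have [_ _ _ tgE] := eggE.
have [U1 tg1] := tgE _ A1E; have [U2 tg2] := tgE _ A2E.
have fr1 := egg_spread_frame eggE fr A1E A2E A3E A4E BE A21 A13 A14 B1 good1 tg1.
have fr2 := egg_spread_frame eggE fr' A2E A1E A3E A4E BE A12 A23 A24 B2 good2 tg2.
pose is_slope1 := slope (spread_elt E A1 U1) c2 c3 c4.
pose is_slope2 := slope (spread_elt E A2 U2) c1 c3 c4.
pose S := [set M : 'M[F]_n'.+1 | [exists X in E, [&& X != A1, X != A2 &
  [forall v in X, c4 v == c3 v *m M]]]].
have S1 M : M \in S <-> is_slope1 M.
  rewrite inE; split=> [/exists_inP[X XE /and3P[XA1 XA2 /forall_inP HX]]|].
    apply: (egg_slope eggE fr A1E A2E A3E A4E BE A21 A13 A14 B1 good1 tg1 XE XA1 XA2) => v vX.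
    exact/eqP/HX.
  case/(slope_egg eggE fr A1E A2E A3E A4E BE A21 A13 A14 B1 good1 tg1) => X XE [XA1 XA2 HX].
  by apply/exists_inP; exists X => //; rewrite XA1 XA2; apply/forall_inP => v /HX/eqP.
(* The slopes modulo [A2] belong to the same set, so they too commute with [K]. *)
have S2 M : is_slope2 M -> M \in S.
  case/(slope_egg eggE fr' A2E A1E A3E A4E BE A12 A23 A24 B2 good2 tg2) => X XE [XA2 XA1 HX].
  by rewrite inE; apply/exists_inP; exists X => //; rewrite XA1 XA2; apply/forall_inP => v /HX/eqP.
have S_1 : 1 \in S by apply/S1; exact: (slope1 fr1).
have S_B : {in S &, forall M N, M - N \in S}.
  by move=> M N /S1 sM /S1 sN; apply/S1/(slopeD fr1) => //; apply: slopeN fr1 _ sN.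
have S_M : {in S &, forall M N, M * N \in S}.
  by move=> M N /S1 sM /S1 sN; apply/S1/(slopeM fr1).
have S_unit : {in S, forall M, M != 0 -> M \is a GRing.unit}.
  move=> M /S1 sM M0; rewrite -[_ \is a _]/(M \in unitmx) -row_free_unit; apply/inj_row_free => v vM.
  by apply/eqP; apply: contraNT M0 => v0; apply/eqP/(slope_inj fr1 sM v0).
have [K [iota [inj_iota iotaD iotaM iota1 iotaP]]] := matrix_fieldP S_1 S_B S_M S_unit.
have iotaS a : iota a \in S by apply/iotaP; exists a.
have iotaB a b : iota (a - b) = iota a - iota b.
  by apply/eqP; rewrite eq_sym subr_eq -iotaD subrK.
have commS M N : M \in S -> N \in S -> M *m N = N *m M.
  by move=> /iotaP[a <-] /iotaP[b <-]; rewrite -[LHS]iotaM mulrC iotaM.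
(* A nonzero vector at which slopes are evaluated: [slope_inj] makes the evaluation injective and
   [slope_transitive] makes it onto. *)
pose e : 'rV[F]_n'.+1 := delta_mx 0 0.
have e0 : e != 0.
  by apply/eqP => /rowP/(_ 0); rewrite !mxE !eqxx => /eqP; rewrite oner_eq0.
pose rho a := e *m iota a.
have rho_inj : injective rho.
  move=> a b; rewrite /rho => eab; apply: inj_iota; apply/eqP; rewrite -subr_eq0 -iotaB.
  apply/eqP/(slope_inj fr1 _ e0); first exact/S1.
  by rewrite iotaB mulmxBr eab subrr.
have rho_onto r : exists a, rho a = r.
  have [M /S1/iotaP[a aM] eM] := slope_transitive fr1 r e0.
  by exists a; rewrite /rho aM.
have [g gK] : exists g : 'rV[F]_n'.+1 -> K, cancel g rho.
  by have /fin_all_exists[g gK] := rho_onto; exists g.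
have Kg : cancel rho g by move=> a; apply: rho_inj; rewrite gK.
have gD : {morph g : r s / r + s}.
  by move=> r s; apply: rho_inj; rewrite gK /rho iotaD mulmxDr -!/(rho _) !gK.
have gZ a r s : g s = a * g r -> s = r *m iota a.
  by move=> /(congr1 rho); rewrite gK /rho mulrC iotaM mulmxA -/(rho (g r)) gK.
have cardK : #|K| = (#|F| ^ n'.+1)%N.
  rewrite (bij_eq_card (Bijective Kg gK)) card_mx mul1n.
  by [].
pose phi v : 'rV[K]_(2 * 1 + 2) :=
  \row_(i < 2 * 1 + 2) g (nth 0 [:: c1 v; c2 v; c3 v; c4 v] i).
have phiE v v' (P : 'rV[F]_n'.+1 -> 'rV[F]_n'.+1 -> Prop) (Q : K -> K -> Prop) :
    (forall r s, Q (g r) (g s) -> P r s) -> (forall i, Q (phi v 0 i) (phi v' 0 i)) ->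
    [/\ P (c1 v) (c1 v'), P (c2 v) (c2 v'), P (c3 v) (c3 v') & P (c4 v) (c4 v')].
  move=> QP HQ.
  have HP (i : 'I_4) : P (nth 0 [:: c1 v; c2 v; c3 v; c4 v] i)
                         (nth 0 [:: c1 v'; c2 v'; c3 v'; c4 v'] i).
    by apply: QP; have := HQ i; rewrite !mxE.
  by split; [apply: (HP (@Ordinal 4 0 _)) | apply: (HP (@Ordinal 4 1 _))
    | apply: (HP (@Ordinal 4 2 _)) | apply: (HP (@Ordinal 4 3 _))].
have phi_inj : injective phi.
  move=> v v' vv'.
  have [e1 e2 e3 e4] := @phiE v v' (fun r s => r = s) (fun a b => a = b) (can_inj gK)
    (fun i => congr1 (fun M : 'rV_(2 * 1 + 2) => M 0 i) vv').
  by apply/eqP; rewrite -subr_eq0; apply/eqP/inj; rewrite linearB /= ?e1 ?e2 ?e3 ?e4 subrr.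
exists K, phi; split=> //.
- apply: inj_card_bij phi_inj _.
  by rewrite card_mx [leqRHS]card_mx cardK -expnM dimE4 leqnn.
- move=> u v; apply/rowP => -[i lti]; rewrite !mxE /=.
  by case: i lti => [|[|[|[|]]]] //= _; rewrite linearD gD.
move=> A a v v' AE vA phiv.
have [e1 e2 e3 e4] : [/\ c1 v' = c1 v *m iota a, c2 v' = c2 v *m iota a,
    c3 v' = c3 v *m iota a & c4 v' = c4 v *m iota a].
  apply: (@phiE v v' (fun r s => s = r *m iota a) (fun b b' => b' = a * b)).
    by move=> r s; apply: gZ.
  by move=> i; rewrite phiv mxE.
(* [A + A1] is a spread element only for [A != A1], and likewise for [A2]; these two are stable
   because vanishing coordinates define them. *)
have [AA1|AA1] := eqVneq A A1.
  move: vA; rewrite AA1 => /m1[v2 v3 v4].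
  by apply/m1; rewrite e2 e3 e4 v2 v3 v4 !mul0mx.
have [AA2|AA2] := eqVneq A A2.
  move: vA; rewrite AA2 => /m2[v1 v3 v4].
  by apply/m2; rewrite e1 e3 e4 v1 v3 v4 !mul0mx.
have vAA X : v \in (A + X)%VS by rewrite (subvP (addvSl _ _)).
have : v' \in (A + A1)%VS.
  apply: (spread_stable fr1 _ _ (vAA A1) e2 e3 e4); last by left; exists A.
  by move=> M /S1 MS; apply: commS.
have : v' \in (A + A2)%VS.
  apply: (spread_stable fr2 _ _ (vAA A2) e1 e3 e4); last by left; exists A.
  by move=> M /S2 MS; apply: commS.
(* Both decompositions are of [v'], so [a2] lies in [A + A1], which is skew from [A2]. *)
case/memv_addP => x xA [a2 a2A ->] /memv_addP[y yA [a1 a1A xy]].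
suff -> : a2 = 0 by rewrite addr0.
apply/eqP; rewrite -memv0 -(egg_cap3 n_gt0 m_gt0 eggE AE A1E A2E) // memv_cap a2A andbT.
have -> : a2 = (y - x) + a1 by rewrite addrAC -xy addrC addrA addNr add0r.
by rewrite memv_add ?rpredB.
Qed.

(** * Affine points and lines of T(E) *)

Section Hull.
Variables (F : finFieldType) (k : nat).
Local Notation V := 'rV[F]_k.
Local Notation W := 'rV[F]_(k + 1).
Local Notation Sinf := (@hyperplane_infinity F k).
Implicit Types (U A : {vspace V}) (X : {vspace W}).

Definition affine_vector (v : V) : W := row_mx v 1%:M.

(* The subspace of W whose affine points form the coset v + U. *)
Definition hull (v : V) U : {vspace W} := (<[affine_vector v]> + at_infinity U)%VS.

Lemma mem_at_infinity u (w : 'rV[F]_1) U :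
  (row_mx u w \in at_infinity U) = (u \in U) && (w == 0).
Proof.
apply/memv_imgP/andP => [[u' u'U]|[uU /eqP->]]; last by exists u; rewrite ?lfunE.
by rewrite lfunE => /eq_row_mx[-> ->].
Qed.

Lemma at_infinityS U A : (at_infinity A <= at_infinity U)%VS = (A <= U)%VS.
Proof.
apply/idP/idP => [/subvP AU|]; last exact: limgS.
by apply/subvP => a aA; have := AU (row_mx a 0); rewrite !mem_at_infinity aA eqxx !andbT; apply.
Qed.

Lemma dim_at_infinity U : \dim (at_infinity U) = \dim U :> nat.
Proof.
rewrite limg_dim_eq //; apply/vs_capP => v _; rewrite memv_ker lfunE /= => /eqP v0.
by move/eqP: v0; rewrite -row_mx0 => /eqP/eq_row_mx[].
Qed.

Lemma affine_vector_neq_inf v : affine_vector v \notin Sinf.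
Proof. by rewrite mem_at_infinity negb_and oner_eq0 orbT. Qed.

Lemma mem_hull v U w : (affine_vector w \in hull v U) = (w - v \in U).
Proof.
apply/memv_addP/idP => [[_ /vlineP[c ->] [z]]|wvU].
  rewrite -[z]hsubmxK mem_at_infinity => /andP[zU /eqP->].
  rewrite /affine_vector scale_row_mx add_row_mx addr0 => /eq_row_mx[-> /matrixP/(_ 0 0)].
  by rewrite !mxE /= mulr1 => <-; rewrite scale1r addrC addKr.
exists (affine_vector v); first exact: memv_line.
exists (row_mx (w - v) 0); first by rewrite mem_at_infinity wvU eqxx.
by rewrite add_row_mx addr0 addrC subrK.
Qed.

Lemma at_infinity_hull v U A : (at_infinity A <= hull v U)%VS = (A <= U)%VS.
Proof.
apply/idP/idP => [/subvP AU|AU]; last by rewrite (subv_trans _ (addvSr _ _)) ?at_infinityS.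
apply/subvP => a aA; rewrite -[a](addrK v) -mem_hull.
rewrite (_ : affine_vector (a + v) = row_mx a 0 + affine_vector v); last first.
  by rewrite add_row_mx add0r.
rewrite rpredD //; first by apply: AU; rewrite mem_at_infinity aA eqxx.
by rewrite (subvP (addvSl _ _)) ?memv_line.
Qed.

Lemma hull_sub v U w A : (hull w A <= hull v U)%VS = (A <= U)%VS && (w - v \in U).
Proof. by rewrite subv_add at_infinity_hull -memvE mem_hull andbC. Qed.

Lemma hull_eq v U w A : hull w A = hull v U <-> A = U /\ w - v \in U.
Proof.
split=> [eqWA|[-> wvU]].
  have : (hull w A <= hull v U)%VS by rewrite eqWA.
  have : (hull v U <= hull w A)%VS by rewrite eqWA.
  rewrite !hull_sub => /andP[UA _] /andP[AU ->]; split=> //.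
  by apply/eqP; rewrite eqEsubv AU.
apply/eqP; rewrite eqEsubv !hull_sub subvv wvU /=.
by rewrite -opprB rpredN.
Qed.

Lemma hull_cap v U : (hull v U :&: Sinf)%VS = at_infinity U.
Proof.
apply/eqP; rewrite eqEsubv subv_cap at_infinity_hull subvv at_infinityS subvf !andbT.
apply/subvP => _ /memv_capP[/memv_addP[_ /vlineP[c ->] [z zU ->]]].
have [z' zE z'U] : exists2 z', z = row_mx z' 0 & z' \in U.
  move: zU; rewrite -[z]hsubmxK mem_at_infinity => /andP[? /eqP->].
  by exists (lsubmx z); rewrite ?row_mxKl.
rewrite zE {1}/affine_vector scale_row_mx add_row_mx mem_at_infinity addr0 => /andP[_].
move/eqP/matrixP/(_ 0 0); rewrite !mxE /= mulr1 => ->.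
by rewrite scale0r add0r scale0r mem_at_infinity z'U eqxx.
Qed.

Lemma hull_dim v U : \dim (hull v U) = (\dim U).+1 :> nat.
Proof.
have cap0 : (<[affine_vector v]> :&: at_infinity U)%VS = 0%VS.
  apply: vs_capP => w /vlineP[c ->]; rewrite scale_row_mx mem_at_infinity.
  case/andP=> _ /eqP/matrixP/(_ 0 0); rewrite !mxE /= mulr1 => ->.
  by rewrite !scale0r row_mx0.
have := dimv_sum_cap <[affine_vector v]> (at_infinity U).
rewrite cap0 dimv0 dim_at_infinity dim_vline.
suff -> : affine_vector v != 0 by rewrite -/(hull v U) addn0 add1n.
by apply: contraNneq (affine_vector_neq_inf v) => ->; rewrite mem0v.
Qed.

(** A vector of [X] outside the hyperplane at infinity has a nonzero last coordinate; scaling this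
    to 1 gives [v]. *)
Lemma hullP X U : \dim X = (\dim U).+1 :> nat -> (X :&: Sinf)%VS = at_infinity U ->
  exists v, X = hull v U.
Proof.
move=> dX XU; have /subvPn[x xX xS] : ~~ (X <= Sinf)%VS.
  apply/negP => XS; move: dX; rewrite -dim_at_infinity -XU (capv_idPl XS).
  by move/esym/eqP; rewrite -[X in _ == X]addn0 -addn1 eqn_add2l.
pose c := rsubmx x 0 0.
have c0 : c != 0.
  apply: contra xS => /eqP c0; rewrite -[x]hsubmxK mem_at_infinity memvf /=.
  by apply/eqP/matrixP => i j; rewrite !ord1 -/c c0 mxE.
exists (c^-1 *: lsubmx x); apply/eqP; rewrite eq_sym eqEdim hull_dim dX leqnn andbT.
rewrite subv_add -XU capvSl andbT -memvE.
suff -> : affine_vector (c^-1 *: lsubmx x) = c^-1 *: x by rewrite rpredZ.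
rewrite -[RHS]hsubmxK; congr row_mx; apply/matrixP => i j; rewrite !mxE //.
by rewrite !ord1 /= -[LHS](mulVf c0) /c mxE.
Qed.

Lemma affine_hullP X : \dim X = 1%N :> nat -> ~~ (X <= Sinf)%VS -> exists v, X = hull v 0%VS.
Proof.
move=> dX XS; apply: hullP; first by rewrite dimv0.
apply/eqP; rewrite /at_infinity limg0 -dimv_eq0.
have : \dim (X :&: Sinf)%VS != \dim X.
  apply: contra XS => /eqP dXS; apply/capv_idPl/eqP.
  by rewrite eqEdim capvSl dXS leqnn.
by have := dimvS (capvSl X Sinf); rewrite dX; case: (\dim _) => [|[]].
Qed.

Lemma hull_not_inf v U : ~~ (hull v U <= Sinf)%VS.
Proof. by rewrite subv_add -memvE (negPf (affine_vector_neq_inf v)). Qed.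

End Hull.

Section EggGeometry.
Variables (F : finFieldType) (n m : nat) (E : {set {vspace 'rV[F]_(2 * n + m)}}).

Lemma affine_pointP (P : affine_point F n m) : exists v, val P = hull v 0%VS.
Proof. by case: P => P /= /andP[/eqP dP PS]; apply: affine_hullP. Qed.

Lemma affine_point_of v : exists P : affine_point F n m, val P = hull v 0%VS.
Proof.
have cond : (\dim (hull v 0%VS) == 1%N) &&
    ~~ (hull v 0%VS <= @hyperplane_infinity F (2 * n + m))%VS.
  by rewrite hull_dim dimv0 hull_not_inf.
by exists (Sub (hull v 0%VS) cond).
Qed.

Lemma tangent_pointP (X : tangent_point E) : exists v A U,
  [/\ A \in E, is_tangent E A U & val X = hull v U].
Proof.
case: X => X /= /andP[/eqP dX /exists_inP[A AE /existsP[U /andP[tgU /eqP XU]]]].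
have [v vE] : exists v, X = hull v U.
  by apply: hullP => //; rewrite dX (tangent_dim tgU).
by exists v, A, U.
Qed.

Lemma tangent_point_of v A U : A \in E -> is_tangent E A U ->
  exists X : tangent_point E, val X = hull v U.
Proof.
move=> AE tgU; have cond : (\dim (hull v U) == (n + m).+1) &&
    [exists A in E, exists U', is_tangent E A U' &&
       (hull v U :&: @hyperplane_infinity F (2 * n + m) == at_infinity U')%VS].
  rewrite hull_dim (tangent_dim tgU) eqxx; apply/exists_inP; exists A => //.
  by apply/existsP; exists U; rewrite tgU hull_cap eqxx.
by exists (Sub (hull v U) cond).
Qed.

Hypothesis dimE : forall A, A \in E -> \dim A = n :> nat.

Lemma affine_lineP (L : affine_line E) : exists v A, A \in E /\ val L = hull v A.
Proof.
case: L => L /= /andP[/eqP dL /exists_inP[A AE /eqP LA]].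
have [v vE] : exists v, L = hull v A by apply: hullP => //; rewrite dL dimE.
by exists v, A.
Qed.

Lemma affine_line_of v A : A \in E -> exists L : affine_line E, val L = hull v A.
Proof.
move=> AE; have cond : (\dim (hull v A) == n.+1) &&
    [exists B in E, (hull v A :&: @hyperplane_infinity F (2 * n + m) == at_infinity B)%VS].
  by rewrite hull_dim dimE // eqxx; apply/exists_inP; exists A; rewrite // hull_cap eqxx.
by exists (Sub (hull v A) cond).
Qed.

End EggGeometry.

(** * Isomorphisms induced by additive bijections *)

Lemma isomorphic_of_rel (G H : incidence) (rp : point G -> point H -> Prop)
    (rl : line G -> line H -> Prop) :
  (forall P, exists P', rp P P') -> (forall P', exists P, rp P P') ->
  (forall L, exists L', rl L L') -> (forall L', exists L, rl L L') ->
  (forall P Q P', rp P P' -> rp Q P' -> P = Q) ->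
  (forall P P' Q', rp P P' -> rp P Q' -> P' = Q') ->
  (forall L M L', rl L L' -> rl M L' -> L = M) ->
  (forall L L' M', rl L L' -> rl L M' -> L' = M') ->
  (forall P P' L L', rp P P' -> rl L L' -> inc P' L' = inc P L) ->
  isomorphic G H.
Proof.
move=> /fin_all_exists[f rf] /fin_all_exists[f' rf'] /fin_all_exists[g rg] /fin_all_exists[g' rg'].
move=> injp funp injl funl incE; exists f, g; split; last by move=> P L; apply: incE.
- by exists f' => P; [apply: injp (rf' _) (rf _) | apply: funp (rf _) (rf' _)].
- by exists g' => L; [apply: injl (rg' _) (rg _) | apply: funl (rg _) (rg' _)].
Qed.

Section EggIsomorphism.
Variables (F K : finFieldType) (n m n' m' : nat).
Variables (E : {set {vspace 'rV[F]_(2 * n + m)}}) (O : {set {vspace 'rV[K]_(2 * n' + m')}}).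
Variable phi : 'rV[F]_(2 * n + m) -> 'rV[K]_(2 * n' + m').
Hypotheses (phi_bij : bijective phi) (phiD : {morph phi : u v / u + v}).

Definition corresp (U : {vspace 'rV[F]_(2 * n + m)}) (U' : {vspace 'rV[K]_(2 * n' + m')}) :=
  forall v, (v \in U) = (phi v \in U').

Hypotheses (dimE : forall A, A \in E -> \dim A = n :> nat)
  (dimO : forall B, B \in O -> \dim B = n' :> nat).
Hypotheses
  (eltE : forall A, A \in E -> exists2 B, B \in O & corresp A B)
  (eltO : forall B, B \in O -> exists2 A, A \in E & corresp A B)
  (tgE : forall A U, A \in E -> is_tangent E A U ->
     exists B U', [/\ B \in O, is_tangent O B U' & corresp U U'])
  (tgO : forall B U', B \in O -> is_tangent O B U' ->
     exists A U, [/\ A \in E, is_tangent E A U & corresp U U']).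

Lemma phiB : {morph phi : u v / u - v}.
Proof.
by move=> u v; apply/eqP; rewrite eq_sym subr_eq -phiD subrK.
Qed.

Lemma corresp_inj U V U' : corresp U U' -> corresp V U' -> U = V.
Proof. by move=> UU' VU'; apply/vspaceP => v; rewrite UU' VU'. Qed.

Lemma corresp_fun U U' V' : corresp U U' -> corresp U V' -> U' = V'.
Proof.
case: phi_bij => psi _ psiK UU' UV'; apply/vspaceP => w.
by rewrite -[w]psiK -UU' UV'.
Qed.

Lemma corresp_sub U U' V V' : corresp U U' -> corresp V V' -> (U' <= V')%VS = (U <= V)%VS.
Proof.
case: phi_bij => psi _ psiK UU' VV'; apply/subvP/subvP => sUV w.
  by rewrite UU' VV'; apply: sUV.
by rewrite -[w]psiK -UU' -VV'; apply: sUV.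
Qed.

Lemma corresp0 : corresp 0%VS 0%VS.
Proof.
move=> v; rewrite !memv0; have phi0 : phi 0 = 0 by rewrite -[0 in LHS](subrr 0) phiB subrr.
by rewrite -phi0 (inj_eq (bij_inj phi_bij)).
Qed.

(** The coset [v + U] goes to [phi v + U']. As [phi] is additive between spaces over possibly
    different fields, subspaces at infinity and affine points are matched through cosets rather than
    by a linear map. *)
Definition hull_corresp X X' := exists v U U',
  [/\ X = hull v U, X' = hull (phi v) U' & corresp U U'].

Lemma hull_corresp_fun X X' Y' : hull_corresp X X' -> hull_corresp X Y' -> X' = Y'.
Proof.
move=> [v [U [U' [XE XE' UU']]]] [w [V [V' [YE YE' VV']]]].
move: YE; rewrite XE => /hull_eq[UV vw]; rewrite XE' YE'; apply/hull_eq.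
by rewrite -phiB -VV' vw; split=> //; apply: corresp_fun UU' _; rewrite UV.
Qed.

Lemma hull_corresp_inj X Y X' : hull_corresp X X' -> hull_corresp Y X' -> X = Y.
Proof.
move=> [v [U [U' [XE XE' UU']]]] [w [V [V' [YE YE' VV']]]].
move: YE'; rewrite XE' => /hull_eq[UV' vw]; rewrite XE YE; apply/hull_eq.
rewrite VV' phiB vw; split=> //; apply: corresp_inj UU' _; rewrite UV'; exact: VV'.
Qed.

Lemma hull_corresp_sub X Y X' Y' : hull_corresp X X' -> hull_corresp Y Y' ->
  (X' <= Y')%VS = (X <= Y)%VS.
Proof.
move=> [v [U [U' [-> -> UU']]]] [w [V [V' [-> -> VV']]]].
by rewrite !hull_sub (corresp_sub UU' VV') VV' phiB.
Qed.

Lemma hull_corresp_inf X X' A A' : hull_corresp X X' -> corresp A A' ->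
  (at_infinity A' <= X')%VS = (at_infinity A <= X)%VS.
Proof.
move=> [v [U [U' [-> -> UU']]]] AA'.
by rewrite !at_infinity_hull (corresp_sub AA' UU').
Qed.

Definition point_corresp (P : TE_point E) (P' : TE_point O) : Prop :=
  match P, P' with
  | None, None => True
  | Some (inl X), Some (inl X') => hull_corresp (val X) (val X')
  | Some (inr X), Some (inr X') => hull_corresp (val X) (val X')
  | _, _ => False
  end.

Definition line_corresp (L : TE_line E) (L' : TE_line O) : Prop :=
  match L, L' with
  | inl X, inl X' => hull_corresp (val X) (val X')
  | inr A, inr A' => corresp (val A) (val A')
  | _, _ => False
  end.

Lemma TE_isomorphic : isomorphic (TE E) (TE O).
Proof.
have psi_ex w : exists v, phi v = w by case: phi_bij => psi _ psiK; exists (psi w).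
apply: (@isomorphic_of_rel (TE E) (TE O) point_corresp line_corresp).
- case=> [[X|X]|]; last by exists None.
    have [v vE] := affine_pointP X; have [X' vE'] := @affine_point_of K n' m' (phi v).
    exists (Some (inl X')), v, 0%VS, 0%VS; split=> //; exact: corresp0.
  have [v [A [U [AE tgU vE]]]] := tangent_pointP X.
  have [B [U' [BO tgU' UU']]] := tgE AE tgU.
  have [X' vE'] := tangent_point_of (phi v) BO tgU'.
  by exists (Some (inr X')), v, U, U'.
- case=> [[X'|X']|]; last by exists None.
    have [w vE'] := affine_pointP X'; have [v vw] := psi_ex w.
    have [X vE] := @affine_point_of F n m v.
    exists (Some (inl X)), v, 0%VS, 0%VS; rewrite vw; split=> //; exact: corresp0.
  have [w [B [U' [BO tgU' vE']]]] := tangent_pointP X'; have [v vw] := psi_ex w.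
  have [A [U [AE tgU UU']]] := tgO BO tgU'.
  have [X vE] := tangent_point_of v AE tgU.
  by exists (Some (inr X)), v, U, U'; rewrite vw.
- case=> [L|[A AE]].
    have [v [A [AE vE]]] := affine_lineP dimE L; have [B BO AB] := eltE AE.
    by have [L' vE'] := affine_line_of dimO (phi v) BO; exists (inl L'), v, A, B.
  by have [B BO AB] := eltE AE; exists (inr (Sub B BO)).
- case=> [L'|[B BO]].
    have [w [B [BO vE']]] := affine_lineP dimO L'; have [A AE AB] := eltO BO.
    have [v vw] := psi_ex w.
    by have [L vE] := affine_line_of dimE v AE; exists (inl L), v, A, B; rewrite vw.
  by have [A AE AB] := eltO BO; exists (inr (Sub A AE)).
- move=> [[P|P]|] [[Q|Q]|] [[P'|P']|] //= PP' QP'; congr (Some (_ _));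
    exact/val_inj/(hull_corresp_inj PP' QP').
- move=> [[P|P]|] [[P'|P']|] [[Q'|Q']|] //= PP' PQ'; congr (Some (_ _));
    exact/val_inj/(hull_corresp_fun PP' PQ').
- move=> [L|A] [M|B] [L'|A'] //= LL' ML'; congr (_ _); apply: val_inj.
    exact: hull_corresp_inj LL' ML'.
  exact: corresp_inj LL' ML'.
- move=> [L|A] [L'|A'] [M'|B'] //= LL' ML'; congr (_ _); apply: val_inj.
    exact: hull_corresp_fun LL' ML'.
  exact: corresp_fun LL' ML'.
move=> [[P|P]|] [[P'|P']|] [L|A] [L'|A'] //= PP' LL'.
- exact: hull_corresp_sub PP' LL'.
- exact: hull_corresp_sub LL' PP'.
- exact: hull_corresp_inf PP' LL'.
Qed.

End EggIsomorphism.

(** * Counting the points not collinear with a given point *)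

Lemma card_bigcup_le (I T : finType) (A : {set I}) (B : I -> {set T}) b :
  (forall i, i \in A -> #|B i| <= b)%N -> (#|\bigcup_(i in A) B i| <= #|A| * b)%N.
Proof.
move=> leB; rewrite -sum_nat_const; elim/big_rec2: _ => [|i S r iA IH]; first by rewrite cards0.
by rewrite (leq_trans (leq_card_setU _ _)) // leq_add ?leB.
Qed.

(** Such a point is reached through one of s points [Q != p] of [L0], one of t lines [M != L0] on
    [Q], and is one of the s points of [M] other than [Q]. *)
Lemma gq_noncollinear (s t : nat) (G : incidence) (p : point G) (L0 : line G) :
  is_gq s t G -> inc p L0 ->
  (#|[set P : point G | [forall L : line G, inc P L ==> ~~ inc p L]]| <= s * (t * s))%N.
Proof.
move=> [_ _ cardL cardP ax] pL0.
pose B (Q : point G) := \bigcup_(M in [set M | inc Q M] :\ L0) ([set P | inc P M] :\ Q).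
apply: leq_trans (_ : #|\bigcup_(Q in [set Q | inc Q L0] :\ p) B Q| <= _)%N.
  apply/subset_leq_card/subsetP => P; rewrite inE => /forallP HP.
  have PL0 : ~~ inc P L0 by apply/negP => /(implyP (HP L0)); rewrite pL0.
  have [M [[PM [Q [QM QL0]]] _]] := ax P L0 PL0.
  apply/bigcupP; exists Q.
    rewrite !inE QL0 andbT; apply: contraTneq QM => ->.
    exact: (implyP (HP M)).
  apply/bigcupP; exists M; rewrite !inE ?PM ?QM ?andbT.
    by apply: contraNneq PL0 => <-.
  by apply: contraNneq PL0 => ->.
have cards_le (T : finType) (S : {set T}) x k : x \in S -> #|S| = k.+1 -> (#|S :\ x| <= k)%N.
  by move=> xS; rewrite (cardsD1 x) xS add1n => -[->].
apply: leq_trans (card_bigcup_le (b := t * s) _) _ => [Q|].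
  rewrite !inE => /andP[_ QL0].
  apply: leq_trans (card_bigcup_le (b := s) _) _ => [M|].
    by rewrite !inE => /andP[_ QM]; apply: cards_le; rewrite ?inE.
  by rewrite leq_mul2r cards_le ?orbT ?inE.
by rewrite leq_mul2r cards_le ?orbT ?inE.
Qed.

(** * Subquadrangles *)

Section Subquadrangle.
Variables (F : finFieldType) (n m : nat) (E : {set {vspace 'rV[F]_(2 * n + m)}}).
Hypotheses (n_gt0 : (0 < n)%N) (m_gt0 : (0 < m)%N) (eggE : is_egg E).
Local Notation q := #|F|.
Local Notation V := 'rV[F]_(2 * n + m).

Lemma tangent_elt A C U : A \in E -> C \in E -> is_tangent E C U -> (A <= U)%VS -> A = C.
Proof.
move=> AE CE tgU AU; apply/eqP; apply: contraT => AC.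
have [v vA v0] := egg_neq0 n_gt0 eggE AE.
by case/negP: v0; rewrite -memv0 -(tangent_cap tgU AE AC) memv_cap vA (subvP AU).
Qed.

Variables (G : incidence) (jp : point G -> TE_point E) (jl : line G -> TE_line E).
Hypotheses (gqG : is_gq (q ^ n) (q ^ n) G) (jp_inj : injective jp) (jl_inj : injective jl).
Hypothesis jinc : forall P L, TE_inc (jp P) (jl L) = inc P L.

Let dimE A : A \in E -> \dim A = n :> nat. Proof. exact: egg_dim. Qed.

Lemma egg_line_pointP P L (A : egg_line E) : jl L = inr A -> inc P L ->
  jp P = None \/ exists X v U, [/\ jp P = Some (inr X), val X = hull v U & is_tangent E (val A) U].
Proof.
move=> LA; rewrite -jinc LA; case: (jp P) => [[X|X]|] //=; last by left.
have [v [C [U [CE tgU vE]]]] := tangent_pointP X.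
rewrite vE at_infinity_hull => AU; right; exists X, v, U.
by rewrite (tangent_elt (valP A) CE tgU AU).
Qed.

Lemma affine_line_pointP P L (l : affine_line E) w A : jl L = inl l -> val l = hull w A ->
  A \in E -> inc P L ->
  (exists X v, [/\ jp P = Some (inl X), val X = hull v 0%VS & v - w \in A]) \/
  exists X U, [/\ jp P = Some (inr X), val X = hull w U & is_tangent E A U].
Proof.
move=> Ll lE AE; rewrite -jinc Ll; case: (jp P) => [[X|X]|] //=.
  have [v vE] := affine_pointP X; rewrite vE lE hull_sub sub0v => vw.
  by left; exists X, v.
have [v [C [U [CE tgU vE]]]] := tangent_pointP X.
rewrite vE lE hull_sub => /andP[AU wv]; right; exists X, U.
rewrite (tangent_elt AE CE tgU AU); split; [by [] | | exact: tgU].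
by rewrite vE; apply/hull_eq; rewrite -opprB rpredN.
Qed.

Lemma tangent_point_uniq P Q L l : jl L = inl l -> inc P L -> inc Q L ->
  (forall X, jp P <> Some (inl X)) -> (forall X, jp Q <> Some (inl X)) -> P = Q.
Proof.
move=> Ll PL QL nP nQ; have [w [A [AE lE]]] := affine_lineP dimE l.
case: (affine_line_pointP Ll lE AE PL) => [[X [v [/nP]]]//|[X [U [PX XE tgU]]]].
case: (affine_line_pointP Ll lE AE QL) => [[Y [v [/nQ]]]//|[Y [U' [QY YE tgU']]]].
apply: jp_inj; rewrite PX QY; congr (Some (_ _)); apply: val_inj.
by rewrite XE YE (tangent_inj n_gt0 m_gt0 eggE AE tgU tgU').
Qed.

Variables (L1 L2 L3 : line G) (A1 A2 A3 : egg_line E).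
Hypotheses (L1A : jl L1 = inr A1) (L2A : jl L2 = inr A2) (L3A : jl L3 = inr A3).
Hypothesis A12 : A1 != A2.

Let s_gt1 : (1 < q ^ n)%N. Proof. by case: gqG. Qed.
Let cardL L : #|[set P : point G | inc P L]| = (q ^ n).+1. Proof. by case: gqG. Qed.
Let cardP P : #|[set L : line G | inc P L]| = (q ^ n).+1. Proof. by case: gqG. Qed.

(** A point of [L1] other than the base point is a tangent point at [A1]. The line of [G] joining it
    to a point of [L2] cannot end in a tangent point at [A2], since its egg element would lie in
    both tangent spaces; so it ends in the base point. *)
Lemma sub_base_point : exists P, jp P = None.
Proof.
have [P] : exists P, P \in [set P | inc P L1] by apply/card_gt0P; rewrite cardL.
rewrite inE => PL1; case: (egg_line_pointP L1A PL1) => [?|[X [v [U [PX XE tgU]]]]]; first by exists P.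
have notA2 : ~~ (val A2 <= U)%VS.
  by apply: contra A12 => /(tangent_elt (valP A2) (valP A1) tgU)/val_inj->.
have PL2 : ~~ inc P L2 by rewrite -jinc PX L2A /= XE at_infinity_hull.
have [M [[PM [Q [QM QL2]]] _]] : exists! M, inc P M /\ exists Q, inc Q M /\ inc Q L2.
  by case: gqG => _ _ _ _; apply.
case: (egg_line_pointP L2A QL2) => [?|[Y [w [U' [QY YE tgU']]]]]; first by exists Q.
have A2U' := tangent_sub tgU'.
case ML : (jl M) => [l|A].
  have [x [A [AE lE]]] := affine_lineP dimE l.
  have := PM; have := QM; rewrite -!jinc ML PX QY /= XE YE lE !hull_sub.
  move=> /andP[AU' _] /andP[AU _].
  have AA2 := tangent_elt AE (valP A2) tgU' AU'.
  by rewrite -AA2 AU in notA2.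
have := PM; have := QM; rewrite -!jinc ML PX QY /= XE YE !at_infinity_hull.
move=> AU' AU; case/negP: notA2.
by rewrite -(tangent_elt (valP A) (valP A2) tgU' AU').
Qed.

(** A line other than [L1] through a tangent point of [L1] is affine, and by [tangent_point_uniq]
    its other points are affine. *)
Lemma sub_affine_point : exists P X, jp P = Some (inl X).
Proof.
have [Poo Poo_None] := sub_base_point.
have [P] : exists P, P \in [set P | inc P L1] :\ Poo.
  apply/card_gt0P; rewrite -ltnS; apply: leq_trans (_ : #|[set P | inc P L1]| <= _)%N.
    by rewrite cardL (leq_trans s_gt1).
  by rewrite (cardsD1 Poo) -add1n leq_add2r leq_b1.
rewrite !inE => /andP[PPoo PL1].
case: (egg_line_pointP L1A PL1) => [PN|[X [v [U [PX XE tgU]]]]].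
  by case/eqP: PPoo; apply: jp_inj; rewrite PN.
have [M] : exists M, M \in [set M | inc P M] :\ L1.
  apply/card_gt0P; rewrite -ltnS; apply: leq_trans (_ : #|[set M | inc P M]| <= _)%N.
    by rewrite cardP (leq_trans s_gt1).
  by rewrite (cardsD1 L1) -add1n leq_add2r leq_b1.
rewrite !inE => /andP[ML1 PM]; case ML : (jl M) => [l|A]; last first.
  case/eqP: ML1; apply: jl_inj; rewrite ML L1A; congr inr; apply: val_inj.
  apply: (tangent_elt (valP A) (valP A1) tgU).
  by have := PM; rewrite -jinc PX ML /= XE at_infinity_hull.
have [Q] : exists Q, Q \in [set Q | inc Q M] :\ P.
  apply/card_gt0P; rewrite -ltnS; apply: leq_trans (_ : #|[set Q | inc Q M]| <= _)%N.
    by rewrite cardL (leq_trans s_gt1).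
  by rewrite (cardsD1 P) -add1n leq_add2r leq_b1.
rewrite !inE => /andP[QP QM].
case QX : (jp Q) => [[Y|Y]|]; first by exists Q, Y.
  case/eqP: QP; apply: (tangent_point_uniq ML QM PM) => Z; by rewrite ?QX ?PX.
case/eqP: QP; apply: (tangent_point_uniq ML QM PM) => Z; by rewrite ?QX ?PX.
Qed.

(* Junk value 0 at the points that are not affine. *)
Definition point_vector P : V :=
  if jp P is Some (inl X) then odflt 0 [pick v | val X == hull v 0%VS] else 0.

Lemma point_vectorP P X : jp P = Some (inl X) -> val X = hull (point_vector P) 0%VS.
Proof.
move=> PX; rewrite /point_vector PX; case: pickP => [v /eqP//|H].
by have [v vE] := affine_pointP X; have := H v; rewrite vE eqxx.
Qed.

Definition affine_points := [set P | if jp P is Some (inl _) then true else false].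

Lemma affine_pointsP P : P \in affine_points -> exists X, jp P = Some (inl X).
Proof. by rewrite inE; case: (jp P) => [[X|]|] //; exists X. Qed.

Lemma point_vector_inj : {in affine_points &, injective point_vector}.
Proof.
move=> P Q /affine_pointsP[X PX] /affine_pointsP[Y QY] PQ; apply: jp_inj.
rewrite PX QY; congr (Some (inl _)); apply: val_inj.
by rewrite (point_vectorP PX) (point_vectorP QY) PQ.
Qed.

(** No affine point is collinear with the base point. *)
Lemma card_affine_points : (#|affine_points| <= q ^ (3 * n))%N.
Proof.
have [Poo PooN] := sub_base_point.
have PooL1 : inc Poo L1 by rewrite -jinc PooN L1A.
have := gq_noncollinear gqG PooL1; rewrite -!expnD => le3.
have -> : (3 * n = n + (n + n))%N by rewrite !mulSn mul0n addn0.
apply: leq_trans le3; apply/subset_leq_card/subsetP => P /affine_pointsP[X PX].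
rewrite inE; apply/forallP => L; rewrite -!jinc PX PooN.
by apply/implyP; case: (jl L).
Qed.

(** The line of [G] through [P] meeting [L] is the coset of [A] through [P]. It has q^n + 1 points
    in [G], only one of them not affine, so the whole coset consists of affine points of [G]. *)
Lemma affine_points_shift P L (A : egg_line E) a : P \in affine_points -> jl L = inr A ->
  a \in val A -> exists2 Q, Q \in affine_points & point_vector Q = point_vector P + a.
Proof.
move=> /affine_pointsP[X PX] LA aA; have XE := point_vectorP PX.
have PL : ~~ inc P L by rewrite -jinc PX LA.
have [M [[PM [Q [QM QL]]] _]] : exists! M, inc P M /\ exists Q, inc Q M /\ inc Q L.
  by case: gqG => _ _ _ _; apply.
case ML : (jl M) => [l|B]; last by have := PM; rewrite -jinc PX ML.
have [w [B [BE lE]]] := affine_lineP dimE l.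
have QnA Z : jp Q <> Some (inl Z) by move=> QZ; have := QL; rewrite -jinc QZ LA.
have [Y QY] : exists Y, jp Q = Some (inr Y).
  by case: (affine_line_pointP ML lE BE QM) => [[Z [v [/QnA]]]//|[Y [U [QY _ _]]]]; exists Y.
have BA : B = val A.
  have [v [C [U [CE tgU vE]]]] := tangent_pointP Y.
  have := QL; have := QM; rewrite -!jinc QY ML LA /= lE vE hull_sub at_infinity_hull.
  move=> /andP[BU _] AU.
  by rewrite (tangent_elt BE CE tgU BU) (tangent_elt (valP A) CE tgU AU).
have Pw : point_vector P - w \in val A.
  by have := PM; rewrite -jinc PX ML /= XE lE hull_sub BA => /andP[].
pose T := [set R | inc R M] :\ Q.
have Taff R : R \in T -> R \in affine_points.
  rewrite in_setD1 inE => /andP[RQ RM]; rewrite inE; case RX : (jp R) => [[Z|Z]|] //.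
    by case/eqP: RQ; apply: (tangent_point_uniq ML RM QM) => // Z'; rewrite RX.
  by case/eqP: RQ; apply: (tangent_point_uniq ML RM QM) => // Z'; rewrite RX.
have cardT : #|T| = (q ^ n)%N.
  by have := cardL M; rewrite (cardsD1 Q) inE QM add1n => -[].
have Tsub : point_vector @: T \subset [set x + w | x in val A].
  apply/subsetP => _ /imsetP[R RT ->]; have [Z RZ] := affine_pointsP (Taff R RT).
  apply/imsetP; exists (point_vector R - w); last by rewrite subrK.
  move: RT; rewrite in_setD1 inE -jinc RZ ML /= (point_vectorP RZ) lE hull_sub BA.
  by case/and3P.
have /eqP Teq : point_vector @: T == [set x + w | x in val A].
  rewrite eqEcard Tsub (card_in_imset (in2W (addIr w))) card_subspace (dimE (valP A)).
  rewrite card_in_imset ?cardT ?leqnn // => R R' RT RT'.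
  exact: point_vector_inj (Taff _ RT) (Taff _ RT').
have : point_vector P + a \in [set x + w | x in val A].
  apply/imsetP; exists (point_vector P - w + a); first by rewrite rpredD.
  by rewrite addrAC subrK.
by rewrite -Teq => /imsetP[R RT ->]; exists R; first exact: Taff.
Qed.

(** Shifts along the three given lines and any line [A] at the base point put a coset of [W + A]
    among the at most q^(3n) affine points, so [A] lies in [W]. There are q^n + 1 such lines. *)
Lemma subquadrangle_rich : A1 != A3 -> A2 != A3 -> rich E (val A1 + val A2 + val A3)%VS.
Proof.
move=> A13 A23; set W := (_ + _ + _)%VS.
have [Poo PooN] := sub_base_point.
have dW : \dim W = (3 * n)%N :> nat by rewrite (egg_dim3 eggE) // ?(valP A1) ?(valP A2) ?(valP A3).
have subW L (A : egg_line E) : jl L = inr A -> (val A <= W)%VS.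
  move=> LA; have [P0 [X0 P0X]] := sub_affine_point.
  have P0a : P0 \in affine_points by rewrite inE P0X.
  have shiftA v : v \in (W + val A)%VS ->
      exists2 Q, Q \in affine_points & point_vector Q = point_vector P0 + v.
    case/memv_addP => _ /memv_addP[_ /memv_addP[a1 a1A [a2 a2A ->]] [a3 a3A ->]] [a aA ->].
    have [P1 P1a E1] := affine_points_shift P0a L1A a1A.
    have [P2 P2a E2] := affine_points_shift P1a L2A a2A.
    have [P3 P3a E3] := affine_points_shift P2a L3A a3A.
    have [P4 P4a E4] := affine_points_shift P3a LA aA.
    by exists P4; rewrite // E4 E3 E2 E1 !addrA.
  have sub_img : [set point_vector P0 + v | v in (W + val A)%VS] \subset point_vector @: affine_points.
    apply/subsetP => _ /imsetP[v /shiftA[Q Qa <-] ->].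
    exact: imset_f.
  have := leq_trans (subset_leq_card sub_img) (leq_imset_card _ _).
  rewrite (card_in_imset (in2W (addrI _))) card_subspace => /leq_trans/(_ card_affine_points).
  rewrite leq_exp2l ?finNzRing_gt1 // => le3.
  suff -> : W = (W + val A)%VS by apply: addvSr.
  by apply/eqP; rewrite eqEdim addvSl dW.
pose h L := if jl L is inr A then val A else 0%VS.
have hP L : L \in [set L | inc Poo L] -> exists2 A, jl L = inr A & h L = val A.
  by rewrite inE -jinc PooN /h; case: (jl L) => // A _; exists A.
have h_inj : {in [set L | inc Poo L] &, injective h}.
  move=> L L' /hP[A LA hA] /hP[A' LA' hA']; rewrite hA hA' => /val_inj AA'.
  by apply: jl_inj; rewrite LA LA' AA'.
rewrite /rich -ltnS -(cardP Poo) -(card_in_imset h_inj) ltnS.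
apply/subset_leq_card/subsetP => _ /imsetP[L /hP[A LA ->] ->].
by rewrite inE (valP A) (subW L).
Qed.

End Subquadrangle.

(** * The ovoid *)

Section OvoidOfEgg.
Variables (F K : finFieldType) (n : nat).
Variable E : {set {vspace 'rV[F]_(2 * n + 2 * n)}}.
Variable phi : 'rV[F]_(2 * n + 2 * n) -> 'rV[K]_(2 * 1 + 2).
Hypotheses (n_gt0 : (0 < n)%N) (eggE : is_egg E) (cardK : #|K| = (#|F| ^ n)%N).
Hypotheses (phi_bij : bijective phi) (phiD : {morph phi : u v / u + v}).

(** Phrased with [v'] in place of the inverse of [phi], which is only known to exist. *)
Definition K_stable (U : {vspace 'rV[F]_(2 * n + 2 * n)}) := forall a v v', v \in U -> phi v' = a *: phi v -> v' \in U.

Hypothesis stableE : forall A, A \in E -> K_stable A.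

Let m_gt0 : (0 < 2 * n)%N. Proof. by rewrite muln_gt0. Qed.

Lemma K_stableD U V : K_stable U -> K_stable V -> K_stable (U + V)%VS.
Proof.
case: phi_bij => psi phiK psiK sU sV a w w' /memv_addP[u uU [v vV ->]].
rewrite phiD scalerDr => w'E.
have -> : w' = psi (a *: phi u) + psi (a *: phi v).
  by apply: (can_inj phiK); rewrite phiD !psiK.
by apply: memv_add; [apply: (sU a u) | apply: (sV a v)]; rewrite ?psiK.
Qed.

(** If the multiple of [v] by [a] left [U], it would lie in a stable [X + A]. Multiplying by [a^-1]
    puts [v] in [X + A], hence in [A], which is stable and inside [U]. *)
Lemma K_stable_tangent A U : A \in E -> is_tangent E A U -> K_stable U.
Proof.
case: phi_bij => psi phiK psiK AE tgU a v v' vU v'E.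
have AU := subvP (tangent_sub tgU).
have [a0|a0] := eqVneq a 0.
  have -> : v' = 0; last exact: mem0v.
  have phi0 : phi 0 = 0 by rewrite -[0 in LHS](subrr 0) (phiB phiD) subrr.
  by apply: (can_inj phiK); rewrite v'E a0 scale0r phi0.
apply: contraT => v'U; have [X XE /andP[XA v'X]] := egg_cover n_gt0 m_gt0 eggE AE tgU v'U.
have vX : v \in (X + A)%VS.
  apply: (K_stableD (stableE XE) (stableE AE) (a := a^-1) v'X).
  by rewrite v'E scalerK.
have vA := tangent_cap_rel tgU XE XA vU vX.
by rewrite (AU v' (stableE AE vA v'E)) in v'U.
Qed.

Lemma K_stable_corresp U : K_stable U -> exists U', corresp phi U U'.
Proof.
case: phi_bij => psi phiK psiK sU; exists <<[seq phi v | v in U]>>%VS => v.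
apply/idP/idP => [vU|/coord_span vE].
  by apply: memv_span; apply/imageP; exists v.
have psiD : {morph psi : u w / u + w} by move=> u w; apply: (can_inj phiK); rewrite phiD !psiK.
rewrite -[v]phiK vE; elim/big_ind: _ => [|u w uU wU|i _].
- have -> : psi 0 = 0; last exact: mem0v.
  by apply: (addrI (psi 0)); rewrite -psiD !addr0.
- by rewrite psiD rpredD.
have /imageP[u uU uE] : [seq phi v | v in U]`_i \in [seq phi v | v in U].
  by rewrite mem_nth // size_image.
by rewrite [X in _ *: X]uE; apply: (sU _ u) => //; rewrite psiK.
Qed.

(** Both have the same number of vectors, and [K] has q^n elements. *)
Lemma corresp_dim U U' : corresp phi U U' -> \dim U = (n * \dim U')%N :> nat.
Proof.
case: phi_bij => psi phiK psiK UU'; apply/eqP.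
rewrite -(@eqn_exp2l #|F|) ?finNzRing_gt1 // expnM -cardK.
rewrite -(card_subspace U) -(card_subspace U').
rewrite -(card_imset _ (can_inj phiK)); apply/eqP/eq_card => w.
apply/imsetP/idP => [[v vU ->]|wU]; first by rewrite -UU'.
by exists (psi w); rewrite ?UU' ?psiK.
Qed.

Lemma correspD U V U' V' : corresp phi U U' -> corresp phi V V' ->
  corresp phi (U + V)%VS (U' + V')%VS.
Proof.
case: phi_bij => psi phiK psiK UU' VV' w.
apply/memv_addP/memv_addP => [[u uU [v vV ->]]|[u' uU [v' vV wE]]].
  by exists (phi u); rewrite -?UU' //; exists (phi v); rewrite -?VV' // phiD.
exists (psi u'); first by rewrite UU' psiK.
exists (psi v'); first by rewrite VV' psiK.
by apply: (can_inj phiK); rewrite phiD !psiK.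
Qed.

Lemma correspI U V U' V' : corresp phi U U' -> corresp phi V V' ->
  corresp phi (U :&: V)%VS (U' :&: V')%VS.
Proof. by move=> UU' VV' w; rewrite !memv_cap UU' VV'. Qed.

(** The image of [A] as a subspace over [K]; the default 0 is taken only where there is none, so
    never on [E]. *)
Definition ovoid_elt (A : {vspace 'rV[F]_(2 * n + 2 * n)}) : {vspace 'rV[K]_(2 * 1 + 2)} :=
  odflt 0%VS [pick B : {vspace 'rV[K]_(2 * 1 + 2)} | [forall v, (v \in A) == (phi v \in B)]].

Lemma ovoid_eltP A : A \in E -> corresp phi A (ovoid_elt A).
Proof.
move=> AE; have [B AB] := K_stable_corresp (stableE AE).
rewrite /ovoid_elt; case: pickP => [C /forallP HC v|noB]; first exact/eqP.
by have /negP[] := negbT (noB B); apply/forallP => w; rewrite AB.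
Qed.

Definition ovoid_of_egg := ovoid_elt @: E.
Local Notation O := ovoid_of_egg.

Lemma ovoidP B : B \in O -> exists2 A, A \in E & corresp phi A B.
Proof. by case/imsetP => A AE ->; exists A => //; apply: ovoid_eltP. Qed.

Lemma ovoid_dim U U' d : corresp phi U U' -> \dim U = (d * n)%N :> nat -> \dim U' = d :> nat.
Proof.
move=> /corresp_dim dU; rewrite dU mulnC => /eqP; rewrite eqn_pmul2r //.
by move/eqP.
Qed.

Lemma ovoid_tangent A U B : A \in E -> is_tangent E A U -> corresp phi A B ->
  exists2 U', is_tangent (n := 1) (m := 2) O B U' & corresp phi U U'.
Proof.
move=> AE tgU AB; have [U' UU'] := K_stable_corresp (K_stable_tangent AE tgU).
exists U' => //; apply/and3P; split.
- apply/eqP/(ovoid_dim UU'); rewrite (tangent_dim tgU) mulnDl mul1n //.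
- by rewrite (corresp_sub phi_bij AB UU') (tangent_sub tgU).
apply/forall_inP => C /ovoidP[X XE XC]; apply/implyP => CB.
rewrite -dimv_eq0; apply/eqP/(ovoid_dim (correspI UU' XC)).
rewrite (tangent_cap tgU XE) ?dimv0 //; apply: contraNneq CB => XA.
by apply/eqP; apply: (corresp_fun phi_bij XC); rewrite XA.
Qed.

Lemma ovoid_of_eggP : is_ovoid O.
Proof.
have [cardE dimE _ tgE] := eggE.
split.
- rewrite card_in_imset ?cardE ?cardK -?expnM 1?(mulnC n) // => A B AE BE AB.
  by apply: (corresp_inj (ovoid_eltP AE)); rewrite AB; apply: ovoid_eltP.
- move=> B /ovoidP[A AE AB]; apply/(ovoid_dim AB).
  by rewrite (egg_dim eggE) // mul1n.
- move=> B1 B2 B3 /ovoidP[A1 A1E AB1] /ovoidP[A2 A2E AB2] /ovoidP[A3 A3E AB3] B12 B13 B23.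
  apply: (ovoid_dim (correspD (correspD AB1 AB2) AB3)).
  have neq X Y X' Y' : corresp phi X X' -> corresp phi Y Y' -> X' != Y' -> X != Y.
    move=> XX' YY'; apply: contraNneq => XY; apply/eqP.
    by apply: (corresp_fun phi_bij XX'); rewrite XY.
  by rewrite (egg_dim3 eggE) // ?(neq _ _ _ _ AB1 AB2) ?(neq _ _ _ _ AB1 AB3) ?(neq _ _ _ _ AB2 AB3).
move=> B /ovoidP[A AE AB]; have [U tgU] := tgE A AE.
by have [U' tgU' _] := ovoid_tangent AE tgU AB; exists U'.
Qed.

Lemma ovoid_isomorphic : isomorphic (TE E) (T3 O).
Proof.
have [_ _ _ tgE] := eggE; have [_ dimO _ _] := ovoid_of_eggP.
apply: (@TE_isomorphic F K n (2 * n) 1 2 E O phi) => //.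
- by move=> A AE; apply: (egg_dim eggE).
- by move=> A AE; exists (ovoid_elt A); [apply: imset_f | apply: ovoid_eltP].
- exact: ovoidP.
- move=> A U AE tgU; have AB := ovoid_eltP AE.
  have [U' tgU' UU'] := ovoid_tangent AE tgU AB.
  by exists (ovoid_elt A), U'; split=> //; apply: imset_f.
move=> B U' BO tgU'; have [A AE AB] := ovoidP BO; have [U tgU] := tgE A AE.
have [V' tgV' UV'] := ovoid_tangent AE tgU AB.
exists A, U; split=> //.
by rewrite (tangent_inj _ _ ovoid_of_eggP BO tgU' tgV').
Qed.

End OvoidOfEgg.

(** * From the subquadrangles to the isomorphism *)

Lemma isomorphic_trans (G H I : incidence) :
  isomorphic G H -> isomorphic H I -> isomorphic G I.
Proof.
move=> [f [g [bf bg fg]]] [f' [g' [bf' bg' fg']]].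
exists (f' \o f), (g' \o g); split; [exact: bij_comp | exact: bij_comp |].
by move=> P L; rewrite /= fg' fg.
Qed.
Local Close Scope ring_scope.

Theorem theorem3p9 (F : finFieldType) (n : nat) (n_gt0 : 0 < n)
    (T : incidence) (infty : point T) (HT : is_tgq F n (2 * n) infty)
    (l1 l2 : line T) (l1_infty : inc infty l1) (l2_infty : inc infty l2)
    (l1_neq_l2 : l1 <> l2)
    (Hsub : forall m1 m2 : line T,
       inc infty m1 -> inc infty m2 -> m1 <> m2 ->
       m1 <> l1 -> m1 <> l2 -> m2 <> l1 -> m2 <> l2 ->
       forall l : line T, l = l1 \/ l = l2 ->
       exists (PS : {set point T}) (LS : {set line T}),
         is_subquadrangle (#|F| ^ n) (#|F| ^ n) PS LS /\
         [/\ m1 \in LS, m2 \in LS & l \in LS]) :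
  exists (K : finFieldType) (O : {set {vspace 'rV[K]_(2 * 1 + 2)}}),
    [/\ #|K| = #|F| ^ n, is_ovoid O & isomorphic T (T3 O)].
Proof.
have [E [eggE [f [g [isoTE f_infty]]]]] := HT.
have isoT : isomorphic T (TE E) by exists f, g.
have [[f' fK f'K] [g' gK g'K] fg] := isoTE.
(* For n = 1 the egg is already an ovoid over [F]; otherwise q^n >= 4, the bound used for general
   position. *)
have [n1 | n_neq1] := eqVneq n 1.
  subst n; exists F, E; rewrite expn1; split; [by [] | exact: eggE | exact: isoT].
have m_gt0 : 0 < 2 * n by rewrite muln_gt0.
have q_gt3 : 3 < #|F| ^ n.
  apply: (@leq_trans (2 ^ n)); last by rewrite leq_exp2r // finNzRing_gt1.
  by apply: (@leq_trans (2 ^ 2)); rewrite // leq_exp2l // ltn_neqAle eq_sym n_neq1.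
have egg_line_of l : inc infty l -> exists A : egg_line E, g l = inr A.
  by rewrite -fg f_infty /=; case: (g l) => // A _; exists A.
have inc_infty (A : egg_line E) : inc infty (g' (inr A)).
  by rewrite -fg f_infty g'K.
have [A1 gA1] := egg_line_of _ l1_infty; have [A2 gA2] := egg_line_of _ l2_infty.
have A12 : A1 != A2.
  by apply/eqP => A12; apply: l1_neq_l2; apply: (can_inj gK); rewrite gA1 gA2 A12.
have neq_g' (A B : egg_line E) l : g l = inr B -> A != B -> g' (inr A) <> l.
  by move=> gl /eqP AB lE; apply: AB; move: gl; rewrite -lE g'K => -[].
(* The subquadrangle is viewed inside [TE E] through [f] and [g]; its three given lines become the
   egg elements [A], [B], [C]. *)
have richT (A B C : egg_line E) l : g l = inr A -> l = l1 \/ l = l2 ->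
    B != A1 -> B != A2 -> C != A1 -> C != A2 -> B != C ->
    rich E (val A + val B + val C)%VS.
  move=> gl l12 B1 B2 C1 C2 BC.
  have AB : A != B.
    by case: l12 gl => ->; rewrite ?gA1 ?gA2 => -[<-]; rewrite eq_sym.
  have AC : A != C.
    by case: l12 gl => ->; rewrite ?gA1 ?gA2 => -[<-]; rewrite eq_sym.
  have [|PS [LS [subPS [BL CL lL]]]] := Hsub (g' (inr B)) (g' (inr C))
    (inc_infty B) (inc_infty C) _ (neq_g' _ _ _ gA1 B1) (neq_g' _ _ _ gA2 B2)
    (neq_g' _ _ _ gA1 C1) (neq_g' _ _ _ gA2 C2) l l12.
    by apply: neq_g' BC; rewrite g'K.
  pose G := substructure PS LS.
  pose jp (P : point G) : TE_point E := f (val P).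
  pose jl (L : line G) : TE_line E := g (val L).
  have jp_inj : injective jp := inj_comp (can_inj fK) val_inj.
  have jl_inj : injective jl := inj_comp (can_inj gK) val_inj.
  have jinc P L : TE_inc (jp P) (jl L) = inc P L by apply: fg.
  have jB : jl (exist (fun L => is_true (L \in LS)) _ BL) = inr B by apply: g'K.
  have jC : jl (exist (fun L => is_true (L \in LS)) _ CL) = inr C by apply: g'K.
  have jA : jl (exist (fun L => is_true (L \in LS)) _ lL) = inr A by apply: gl.
  exact: (subquadrangle_rich n_gt0 m_gt0 eggE subPS jp_inj jl_inj jinc jA jB jC).
(* The hypothesis yields the planes avoiding the other special element; [good_of_exception] adds
   those through both. *)
have good1 : good E (val A1).
  apply: (good_of_exception n_gt0 eggE (valP A1) (valP A2) _ (ltnW q_gt3)) => //.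
  move=> X Y XE YE X1 Y1 X2 Y2 XY.
  exact: (richT A1 (Sub X XE) (Sub Y YE) l1 gA1 (or_introl (erefl _))).
have good2 : good E (val A2).
  apply: (good_of_exception n_gt0 eggE (valP A2) (valP A1) _ (ltnW q_gt3)) => //.
    by rewrite eq_sym.
  move=> X Y XE YE X2 Y2 X1 Y1 XY.
  exact: (richT A2 (Sub X XE) (Sub Y YE) l2 gA2 (or_intror (erefl _))).
have egg_ge : 1 < n by rewrite ltn_neqAle eq_sym n_neq1.
have [K [phi [cardK phi_bij phiD stableE]]] : exists (K : finFieldType)
    (phi : 'rV[F]_(2 * n + 2 * n) -> 'rV[K]_(2 * 1 + 2)),
    [/\ #|K| = #|F| ^ n, bijective phi, {morph phi : u v / (u + v)%R} &
      forall A a v v', A \in E -> v \in A -> phi v' = (a *: phi v)%R -> v' \in A].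
  have {}A12 : val A1 != val A2 by rewrite (inj_eq val_inj).
  have [A1E A2E] := (valP A1, valP A2).
  move: (val A1) (val A2) A1E A2E A12 good1 good2.
  (* [n] is turned into a successor, the form of the size in which square matrices carry their ring
     structure. *)
  clear -n_gt0 eggE q_gt3; case: n n_gt0 q_gt3 E eggE => // n' _ q_gt3 E eggE.
  by move=> B1 B2 B1E B2E B12 good1 good2; apply: (egg_field eggE q_gt3 B1E B2E B12).
have stable A (AE : A \in E) : K_stable phi A by move=> a v v'; apply: stableE.
exists K, (ovoid_of_egg E phi); split; first exact: cardK.
  exact: (ovoid_of_eggP n_gt0 eggE cardK phi_bij phiD stable).
exact: (isomorphic_trans isoT (ovoid_isomorphic n_gt0 eggE cardK phi_bij phiD stable)).
Qed.
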